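(* Let $G$ be an unbounded countable abelian group such that $G\cong\bigoplus_{n\in\mathbb{N}} G$. Then there is a comeager set $\mathcal{M}$ of invariant metrics on $G$ such that all $d\in\mathcal{M}$ give rise to the same metric group after completion (i.e. for any $d,d'\in\mathcal{M}$ there is an isometric group isomorphism between the completions of $(G,d)$ and $(G,d')$), and this completion is isometric to the Urysohn space $\mathbb{U}$ and is extremely amenable.
   Context: Abelian groups are written additively. An abelian group $G$ is unbounded if it either contains an element of infinite order or contains elements of arbitrarily high finite orders. A metric $d$ on an abelian group $G$ is invariant if $d(a,b)=d(a+c,b+c)$ for all $a,b,c\in G$. The space of all invariant metrics on a countable group $G$ is a subset of $\mathbb{R}^{G\times G}$ and carries the subspace topology of the product topology (pointwise convergence), with which it is a Polish space; ''comeager'' refers to this space. The completion of $(G,d)$ is the metric completion with the group operations extended by continuity. The Urysohn space $\mathbb{U}$ is the unique (up to isometry) complete separable metric space which contains an isometric copy of every separable metric space and in which every partial isometry between two finite subsets extends to an autoisometry of the whole space. A topological group is extremely amenable if each of its continuous actions on a nonempty compact Hausdorff space has a fixed point. *)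

(* Defs.v *)
From HB Require Import structures.
From mathcomp Require Import all_boot all_order all_algebra.
From mathcomp Require Import ring_quotient lra.
From mathcomp Require Import all_classical all_reals all_analysis.

Set Implicit Arguments.
Unset Strict Implicit.
Unset Printing Implicit Defensive.

Import Order.TTheory GRing.Theory Num.Theory.
Import numFieldNormedType.Exports.

Local Open Scope classical_set_scope.
Local Open Scope ring_scope.
Local Open Scope quotient_scope.

Section AbelianGroups.
Variable G : zmodType.

Definition has_infinite_order (x : G) : Prop :=
  forall n : nat, (0 < n)%N -> x *+ n <> 0.

Definition has_order (x : G) (n : nat) : Prop :=
  [/\ (0 < n)%N, x *+ n = 0 & forall m : nat, (0 < m < n)%N -> x *+ m <> 0].

Definition unbounded_group : Prop :=
  (exists x : G, has_infinite_order x) \/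
  (forall N : nat, exists (x : G) (n : nat), (N <= n)%N /\ has_order x n).

Definition finitely_supported : {pred nat -> G} :=
  [pred f | `[< finite_set [set n | f n != 0] >]].

Lemma finitely_supported_zmod_closed : zmod_closed finitely_supported.
Proof.
split=> [|f g]; rewrite !inE.
  apply: (@sub_finite_set _ _ set0) => [n /=|].
    by rewrite eqxx.
  exact: finite_set0.
move=> ff fg.
apply: (@sub_finite_set _ _ ([set n | f n != 0] `|` [set n | g n != 0])).
  move=> n /=; rewrite !fctE; case: (eqVneq (f n) 0) => [->|]; last by left.
  by rewrite sub0r oppr_eq0; right.
by rewrite finite_setU.
Qed.

HB.instance Definition _ :=
  GRing.isZmodClosed.Build _ finitely_supported finitely_supported_zmod_closed.

Record direct_sum : Type :=
  DirectSum { dsum_val : nat -> G; _ : dsum_val \in finitely_supported }.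
HB.instance Definition _ := [isSub for dsum_val].
HB.instance Definition _ := [Choice of direct_sum by <:].
HB.instance Definition _ := [SubChoice_isSubZmodule of direct_sum by <:].

End AbelianGroups.

Section Topology.
Variable X : topologicalType.

Definition separable : Prop := exists A : set X, countable A /\ dense A.

Definition nowhere_dense (A : set X) : Prop := interior (closure A) = set0.

Definition meager (A : set X) : Prop :=
  exists F : nat -> set X,
    (forall n, nowhere_dense (F n)) /\ A `<=` \bigcup_n F n.

Definition comeager (A : set X) : Prop := meager (~` A).

End Topology.

Definition complete_space (X : uniformType) : Prop :=
  forall F : set_system X, ProperFilter F -> cauchy F -> exists x : X, F --> x.

Section Metric.
Variable R : realType.

Definition is_isometry (X Y : metricType R) (f : X -> Y) : Prop :=
  forall x y, mdist (f x) (f y) = mdist x y.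

Definition isometric_spaces (X Y : metricType R) : Prop :=
  exists2 f : X -> Y, bijective f & is_isometry f.

(** A partial isometry with finite domain [A] is given by the values on [A] of
    a total function; its range is then finite too. *)
Definition finite_partial_isometries_extend (X : metricType R) : Prop :=
  forall (A : set X) (f : X -> X), finite_set A ->
    (forall x y, A x -> A y -> mdist (f x) (f y) = mdist x y) ->
    exists g : X -> X,
      [/\ bijective g, is_isometry g & forall x, A x -> g x = f x].

Definition is_Urysohn_space (U : metricType R) : Prop :=
  [/\ complete_space U, separable U,
      (forall X : metricType R, separable X -> exists f : X -> U, is_isometry f)
    & finite_partial_isometries_extend U].

Definition isometric_to_Urysohn (X : metricType R) : Prop :=
  exists2 U : metricType R, is_Urysohn_space U & isometric_spaces X U.

End Metric.

Definition extremely_amenable (K : topologicalZmodType) : Prop :=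
  forall (X : topologicalType) (act : K -> X -> X),
    [set: X] !=set0 -> compact [set: X] -> hausdorff_space X ->
    (forall x, act 0 x = x) ->
    (forall a b x, act (a + b) x = act a (act b x)) ->
    continuous (fun p : K * X => act p.1 p.2) ->
    exists x, forall a, act a x = x.

Section InvariantMetrics.
Variables (R : realType) (G : zmodType).

(** As a type, [invariant_metrics] carries the library's subspace topology
    inherited from the topology of pointwise convergence. *)
Definition invariant_metrics : set {ptws G * G -> R} :=
  [set d : G * G -> R |
    [/\ forall a b, d (a, b) = 0 <-> a = b,
        forall a b, d (a, b) = d (b, a),
        forall a b c, d (a, c) <= d (a, b) + d (b, c)
      & forall a b c, d (a, b) = d (a + c, b + c)]].

End InvariantMetrics.

Arguments invariant_metrics : clear implicits.

Section CauchySequences.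
Variables (R : realType) (G : zmodType) (d : invariant_metrics R G).

Definition idist (a b : G) : R := set_val d (a, b).

Let dP : invariant_metrics R G (set_val d). Proof. exact: set_valP. Qed.

Lemma idist_eq0 a b : idist a b = 0 <-> a = b.
Proof. by case: dP => + _ _ _; exact. Qed.

Lemma idistxx a : idist a a = 0. Proof. exact/idist_eq0. Qed.

Lemma idistC a b : idist a b = idist b a.
Proof. by case: dP => _ + _ _; exact. Qed.

Lemma idist_triangle b a c : idist a c <= idist a b + idist b c.
Proof. by case: dP => _ _ + _; exact. Qed.

Lemma idistDr c a b : idist (a + c) (b + c) = idist a b.
Proof. by case: dP => _ _ _ h; rewrite /idist -h. Qed.

Lemma idist_ge0 a b : 0 <= idist a b.
Proof.
have := idist_triangle b a a; rewrite idistxx (idistC b a) -mulr2n.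
by rewrite pmulrn_lge0.
Qed.

Lemma idistN a b : idist (- a) (- b) = idist a b.
Proof.
by rewrite -(idistDr (a + b)) addKr addrCA addNr addr0 idistC.
Qed.

Lemma idistB a b a' b' : idist (a - b) (a' - b') <= idist a a' + idist b b'.
Proof.
apply: (le_trans (idist_triangle (a' - b) _ _)).
by rewrite idistDr ![a' - _]addrC idistDr idistN.
Qed.

Lemma idist_diff a b a' b' :
  `|idist a b - idist a' b'| <= idist a a' + idist b b'.
Proof.
have h1 := idist_triangle a a' b'; have h2 := idist_triangle b a b'.
have h3 := idist_triangle a' a b; have h4 := idist_triangle b' a' b.
rewrite (idistC a' a) in h1; rewrite (idistC b' b) in h4.
by rewrite ler_norml; apply/andP; split; lra.
Qed.

Definition cauchy_sequences : {pred nat -> G} :=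
  [pred x | `[< forall e : R, 0 < e -> exists N : nat,
      forall m n, (N <= m)%N -> (N <= n)%N -> idist (x m) (x n) < e >]].

Lemma cauchy_sequences_zmod_closed : zmod_closed cauchy_sequences.
Proof.
split=> [|x y]; rewrite !inE.
  by move=> e e0; exists 0%N => m n _ _; rewrite idistxx.
move=> cx cy e e0.
have e20 : 0 < e / 2 by rewrite divr_gt0.
have [N1 h1] := cx _ e20; have [N2 h2] := cy _ e20.
exists (maxn N1 N2) => m n; rewrite !geq_max => /andP[m1 m2] /andP[n1 n2].
by rewrite (le_lt_trans (idistB _ _ _ _)) // [e]splitr ltrD ?h1 ?h2.
Qed.

HB.instance Definition _ :=
  GRing.isZmodClosed.Build _ cauchy_sequences cauchy_sequences_zmod_closed.

Record cauchy_sequence : Type :=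
  CauchySequence { cseq :> nat -> G; _ : cseq \in cauchy_sequences }.
HB.instance Definition _ := [isSub for cseq].
HB.instance Definition _ := [Choice of cauchy_sequence by <:].
HB.instance Definition _ := [SubChoice_isSubZmodule of cauchy_sequence by <:].

Definition null_sequences : {pred cauchy_sequence} :=
  [pred x : cauchy_sequence | `[< (fun n => idist (x n) 0) @ \oo --> (0 : R) >]].

Lemma cseqB (x y : cauchy_sequence) n : (x - y) n = x n - y n.
Proof. by rewrite -[LHS]/(val (x - y) n) raddfB. Qed.

Lemma null_sequences_zmod_closed : zmod_closed null_sequences.
Proof.
split=> [|x y]; rewrite !inE.
  have -> : (fun n => idist ((0 : cauchy_sequence) n) 0) = cst 0.
    apply/funext => n; rewrite -[(0 : cauchy_sequence) n]/(val (0 : cauchy_sequence) n).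
    by rewrite raddf0 idistxx.
  exact: cvg_cst.
move=> nx ny.
have nxy : (fun n => idist (x n) 0 + idist (y n) 0) @ \oo --> (0 : R).
  by have := cvgD nx ny; rewrite addr0; exact.
apply: (@squeeze_cvgr _ _ _ _ (cst 0) _ _ _ _ (cvg_cst _) nxy).
near=> n; apply/andP; split; first exact: idist_ge0.
by have := idistB (x n) (y n) 0 0; rewrite subr0 -cseqB.
Unshelve. all: by end_near.
Qed.

HB.instance Definition _ :=
  GRing.isZmodClosed.Build _ null_sequences null_sequences_zmod_closed.

(** Cauchy sequences of [(G, d)] modulo null sequences: the group operations
    inherited from the quotient are the termwise ones, that is, those of [G]
    extended by continuity. *)
Definition completion : Type := Quotient.quot null_sequences.
HB.instance Definition _ := GRing.Zmodule.on completion.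

Definition completion_dist (a b : completion) : R :=
  lim ((fun n => idist (repr a n) (repr b n)) @ \oo).

Lemma cauchy_sequenceP (x : cauchy_sequence) (e : R) : 0 < e ->
  exists N, forall m n, (N <= m)%N -> (N <= n)%N -> idist (x m) (x n) < e.
Proof. by case: x => x /= xP; move: xP; rewrite inE; exact. Qed.

Lemma idist_cvg (x y : cauchy_sequence) : cvgn (fun n => idist (x n) (y n)).
Proof.
apply/cauchy_cvgP/cauchy_exP => e e0.
have e20 : 0 < e / 2 by rewrite divr_gt0.
have [N1 h1] := cauchy_sequenceP x e20; have [N2 h2] := cauchy_sequenceP y e20.
pose N := maxn N1 N2; exists (idist (x N) (y N)); exists N => // n /= Nn.
rewrite /ball /= (le_lt_trans (idist_diff _ _ _ _)) // [e]splitr ltrD //.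
  by rewrite h1 ?leq_maxl // (leq_trans (leq_maxl _ _) Nn).
by rewrite h2 ?leq_maxr // (leq_trans (leq_maxr _ _) Nn).
Qed.

Lemma completion_eqP (x y : cauchy_sequence) :
  \pi_completion x = \pi_completion y <->
  (fun n => idist (x n) (y n)) @ \oo --> (0 : R).
Proof.
have -> : (fun n => idist (x n) (y n)) = (fun n => idist ((x - y) n) 0).
  by apply/funext => n; rewrite cseqB -(idistDr (- y n)) subrr.
split=> [/eqP|h]; last apply/eqP; rewrite -Quotient.idealrBE inE //.
Qed.

Lemma completion_dist_pi (x y : cauchy_sequence) :
  (fun n => idist (x n) (y n)) @ \oo -->
  completion_dist (\pi_completion x) (\pi_completion y).
Proof.
rewrite /completion_dist; set x' := repr _; set y' := repr _.
have xx' : (fun n => idist (x n) (x' n)) @ \oo --> (0 : R).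
  by apply/completion_eqP; rewrite reprK.
have yy' : (fun n => idist (y n) (y' n)) @ \oo --> (0 : R).
  by apply/completion_eqP; rewrite reprK.
have /cvg_ex [l l1] := @idist_cvg x' y'.
rewrite (cvg_lim _ l1) //.
have h : (fun n => idist (x n) (x' n) + idist (y n) (y' n)) @ \oo --> (0 : R).
  by have := cvgD xx' yy'; rewrite addr0; exact.
have h' : (fun n => idist (x n) (y n) - idist (x' n) (y' n)) @ \oo --> (0 : R).
  apply/cvgr0Pnorm_le => e e0; have /cvgr0Pnorm_le/(_ e e0) := h.
  apply: filterS => n; apply: le_trans.
  by rewrite (le_trans (idist_diff _ _ _ _)) // ler_norm.
rewrite -[l]add0r (_ : (fun n => _) =
  (fun n => (idist (x n) (y n) - idist (x' n) (y' n)) + idist (x' n) (y' n))).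
  exact: cvgD.
by apply/funext => n; rewrite subrK.
Qed.

Lemma completion_distxx a : completion_dist a a = 0.
Proof.
rewrite /completion_dist (_ : (fun n => _) = cst 0) ?lim_cst //.
by apply/funext => n; rewrite idistxx.
Qed.

Lemma completion_dist_positivity a b : completion_dist a b = 0 -> a = b.
Proof.
move=> ab0; rewrite -[a]reprK -[b]reprK; apply/completion_eqP.
by rewrite -ab0; exact: idist_cvg.
Qed.

Lemma completion_distC a b : completion_dist a b = completion_dist b a.
Proof.
by rewrite /completion_dist; under eq_fun do rewrite idistC.
Qed.

Lemma completion_dist_triangle b a c :
  completion_dist a c <= completion_dist a b + completion_dist b c.
Proof.
rewrite -limD; [|exact: idist_cvg..].
apply: ler_lim; [exact: idist_cvg|exact: is_cvgD (@idist_cvg _ _) (@idist_cvg _ _)|].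
by apply: nearW => n; exact: idist_triangle.
Qed.

HB.instance Definition _ := isMetric.Build R completion completion_distxx
  completion_dist_positivity completion_distC completion_dist_triangle.

Lemma pi_completionB (x y : cauchy_sequence) :
  \pi_completion (x - y) = \pi_completion x - \pi_completion y.
Proof. exact: (raddfB (\pi_completion : {additive cauchy_sequence -> completion})). Qed.

Lemma completion_distB (a b a' b' : completion) :
  mdist (a - b) (a' - b') <= mdist a a' + mdist b b'.
Proof.
rewrite -[a]reprK -[b]reprK -[a']reprK -[b']reprK -!pi_completionB.
have h1 := @completion_dist_pi (repr a - repr b) (repr a' - repr b').
have h2 : (fun n => idist (repr a n) (repr a' n) + idist (repr b n) (repr b' n))
    @ \oo --> completion_dist (\pi_completion (repr a)) (\pi_completion (repr a'))
      + completion_dist (\pi_completion (repr b)) (\pi_completion (repr b')).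
  by apply: cvgD; exact: completion_dist_pi.
apply: (ler_cvg_to h1 h2); apply: nearW => n.
by rewrite !cseqB; exact: idistB.
Qed.

Lemma completion_sub_continuous :
  continuous (fun z : completion * completion => z.1 - z.2).
Proof.
move=> [a b]; apply/cvg_ballP => e e0; have e20 : 0 < e / 2 by rewrite divr_gt0.
exists (ball a (e / 2), ball b (e / 2)) => /=.
  by split; exact: nbhsx_ballx.
move=> [a' b'] /= []; rewrite !ballEmdist /= => ha hb.
by rewrite (le_lt_trans (completion_distB _ _ _ _)) // [e]splitr ltrD.
Qed.

HB.instance Definition _ := PreTopologicalNmodule_isTopologicalZmodule.Build
  completion completion_sub_continuous.

(** The next lemmas check that [completion] is a metric completion of [(G, d)]:
    it is complete, and [to_completion] is an isometric group homomorphism with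
    dense image. *)
Lemma cst_cauchy (g : G) : (fun=> g) \in cauchy_sequences.
Proof. by rewrite inE => e e0; exists 0%N => m n _ _; rewrite idistxx. Qed.

Definition to_completion (g : G) : completion :=
  \pi_completion (CauchySequence (cst_cauchy g)).

Lemma to_completion_zmod_morphism : zmod_morphism to_completion.
Proof.
move=> g h; rewrite /to_completion -pi_completionB; congr (\pi_completion _).
exact: val_inj.
Qed.

HB.instance Definition _ :=
  GRing.isZmodMorphism.Build G completion to_completion
    to_completion_zmod_morphism.

Lemma mdist_to_completion g h :
  mdist (to_completion g) (to_completion h) = idist g h.
Proof.
have h1 := @completion_dist_pi (CauchySequence (cst_cauchy g))
  (CauchySequence (cst_cauchy h)).
have h2 : (fun n => idist (CauchySequence (cst_cauchy g) n)
  (CauchySequence (cst_cauchy h) n)) @ \oo --> idist g h.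
  exact: (@cvg_cst R (idist g h) nat \oo _).
exact: (cvg_unique _ h1 h2).
Qed.

Lemma mdist_to_completion_pi (x : cauchy_sequence) (e : R) (N : nat) :
  (forall n, (N <= n)%N -> idist (x N) (x n) < e) ->
  mdist (to_completion (x N)) (\pi_completion x) <= e.
Proof.
move=> h.
have h1 := @completion_dist_pi (CauchySequence (cst_cauchy (x N))) x.
apply: (ler_cvg_to h1 (cvg_cst e)); exists N => // n /= Nn.
exact/ltW/h.
Qed.

Lemma to_completion_approx (a : completion) (e : R) : 0 < e ->
  exists g, mdist a (to_completion g) < e.
Proof.
move=> e0; have e20 : 0 < e / 2 by rewrite divr_gt0.
have [N h] := cauchy_sequenceP (repr a) e20.
exists (repr a N); rewrite metric_sym -{2}[a]reprK.
rewrite (@le_lt_trans _ _ (e / 2)) //; last by rewrite ltr_pdivrMr // ltr_pMr // ltr1n.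
by apply: mdist_to_completion_pi => n; exact: h.
Qed.

Lemma dense_to_completion : dense (range to_completion).
Proof.
move=> O [a Oa] oO; have /nbhs_ballP [e /= e0 aeO] := open_nbhs_nbhs (conj oO Oa).
have [g ag] := to_completion_approx a e0.
by exists (to_completion g); split; [apply: aeO; rewrite ballEmdist|exists g].
Qed.

Lemma completion_complete : complete_space completion.
Proof.
move=> F FF /cauchyP cF.
have eps0 n : 0 < n.+1%:R^-1 :> R by rewrite invr_gt0.
have /choice [g hg] : forall n : nat, exists g : G,
    F (ball (to_completion g) n.+1%:R^-1).
  move=> n; have e20 : 0 < n.+1%:R^-1 / 2 :> R by rewrite divr_gt0.
  have [a Fa] := cF _ e20; have [g ag] := to_completion_approx a e20.
  exists g; apply: filterS Fa => b; rewrite !ballEmdist /= => ab.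
  rewrite (le_lt_trans (metric_triangle _ a _)) // metric_sym.
  by rewrite [n.+1%:R^-1]splitr ltrD.
have hd m n : idist (g m) (g n) < m.+1%:R^-1 + n.+1%:R^-1.
  have [b []] := filter_ex (filterI (hg m) (hg n)).
  rewrite !ballEmdist /= -mdist_to_completion => h1 h2.
  by rewrite (le_lt_trans (metric_triangle _ b _)) // ltrD // metric_sym.
have small e : 0 < e -> exists N, forall n, (N <= n)%N -> n.+1%:R^-1 < e :> R.
  move=> e0; have [N _ hN] := near_infty_natSinv_lt (PosNum e0).
  by exists N => n Nn; exact: hN.
have gc : g \in cauchy_sequences.
  rewrite inE => e e0; have e20 : 0 < e / 2 by rewrite divr_gt0.
  have [N hN] := small _ e20; exists N => m n Nm Nn.
  by rewrite (lt_trans (hd m n)) // [e]splitr ltrD ?hN.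
exists (\pi_completion (CauchySequence gc)); apply/cvg_ballP => e e0.
have e30 : 0 < e / 3 by rewrite divr_gt0.
have [N hN] := small _ e30.
apply: filterS (hg N) => b; rewrite !ballEmdist /= => gb.
rewrite (le_lt_trans (metric_triangle _ (to_completion (g N)) _)) //.
have : mdist (to_completion (g N)) (\pi_completion (CauchySequence gc))
    <= e / 3 + e / 3.
  apply: (@mdist_to_completion_pi (CauchySequence gc)) => n Nn /=.
  by rewrite (lt_trans (hd N n)) // ltrD ?hN.
rewrite metric_sym; have := lt_trans gb (hN _ (leqnn N)); lra.
Qed.

End CauchySequences.

(* Main.v *)
(** Invariant metrics on [G] are norms. Call a norm [p] generic when, for every
    condition asking that some configuration in [G] (a point, or an
    endomorphism applied to finitely many points) have norms in prescribed
    rational intervals, [p] satisfies it as soon as [p] is a limit of norms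
    that do. The conditions are open and countably many, so generic norms are
    comeager. As [G] is a countable direct power of itself, any seminorm on
    [G * G] extending [p] is copied into [G], up to small errors on a finite set,
    by a norm close to [p] and an injection of the second factor; hence a generic
    [p] realises all the amalgams that can be written down. Three amalgams are
    used.

    - A new point with prescribed distances to finitely many points, which may
      moreover be killed by a large multiple. This is where unboundedness enters.
      It gives the one-point extension property of the completion, hence the
      Urysohn space, and it shows that [p (q x) / q] is arbitrarily small.

    - Two copies of [G] glued along a morphism that is almost isometric on the
      words in a finite set. Because [p (q x) / q] gets small, being almost
      isometric on short words is enough, and back-and-forth between two generic
      norms converges to an isometric isomorphism of the completions.

    - The mean of [n] translates of [p]. It writes an element as a sum of [n]
      elements whose multiples have norm [1 / n] times that of the element. On a
      box spanned by these, Lipschitz functions have small variance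
      (Efron-Stein), so they hardly change along the orbit of the sum: every
      element has a fixed point in every compact invariant set, and
      commutativity gives a common one. *)
Require Import Defs.
From HB Require Import structures.
From mathcomp Require Import all_boot all_order all_algebra.
From mathcomp Require Import ring lra zify.
From mathcomp Require Import all_classical all_reals all_analysis.

Import Order.TTheory GRing.Theory Num.Theory.
Import numFieldNormedType.Exports.

Local Open Scope classical_set_scope.
Local Open Scope ring_scope.

Set Implicit Arguments.
Unset Strict Implicit.
Unset Printing Implicit Defensive.

(** * Seminorms on abelian groups *)

Section Seminorms.
Context {R : realType} {V : zmodType}.

Definition seminorm (p : V -> R) : Prop :=
  [/\ p 0 = 0, forall x, p (- x) = p x & forall x y, p (x + y) <= p x + p y].

Variables (p : V -> R) (sp : seminorm p).

Lemma seminorm0 : p 0 = 0. Proof. by case: sp. Qed.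
Lemma seminormN x : p (- x) = p x. Proof. by case: sp. Qed.
Lemma seminormD x y : p (x + y) <= p x + p y. Proof. by case: sp. Qed.

Lemma seminormB x y : p (x - y) <= p x + p y.
Proof. by rewrite -(seminormN y) seminormD. Qed.

Lemma seminormC x y : p (x - y) = p (y - x).
Proof. by rewrite -seminormN opprB. Qed.

Lemma seminorm_ge0 x : 0 <= p x.
Proof. by have := seminormB x x; rewrite subrr seminorm0; lra. Qed.

Lemma seminorm_trans z x y : p (x - y) <= p (x - z) + p (z - y).
Proof. by have := seminormD (x - z) (z - y); rewrite addrA subrK. Qed.

Lemma seminorm_sum (I : Type) (s : seq I) (P : pred I) (f : I -> V) :
  p (\sum_(i <- s | P i) f i) <= \sum_(i <- s | P i) p (f i).
Proof.
elim/big_rec2: _ => [|i a b _ h]; first by rewrite seminorm0.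
by rewrite (le_trans (seminormD _ _)) // lerD2l.
Qed.

Lemma seminorm_mulrn x n : p (x *+ n) <= p x *+ n.
Proof.
elim: n => [|n ih]; first by rewrite !mulr0n seminorm0.
by rewrite !mulrS (le_trans (seminormD _ _)) // lerD2l.
Qed.

End Seminorms.

(** * Seminorms as infima of costs *)

Section Infimum.
Context {R : realType} {V : zmodType}.

(* [Rel x r]: the element [x] can be reached at cost [r]. *)
Variable Rel : V -> R -> Prop.

(** Once [Rel] is closed under opposites and sums, this is the largest seminorm that respects the
    prescribed costs. The one-point extension and the gluing of two copies of [G] are both obtained
    from it; what remains each time is to show that the old norms do not drop. *)
Definition cost_inf (x : V) : R := inf [set r | Rel x r].

Hypothesis Rel_ge0 : forall x r, Rel x r -> 0 <= r.
Hypothesis Rel_total : forall x, exists r, Rel x r.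

Lemma cost_inf_le x r : Rel x r -> cost_inf x <= r.
Proof. by move=> xr; apply: ge_inf => //; exists 0 => s /Rel_ge0. Qed.

Lemma cost_inf_ge b x : (forall r, Rel x r -> b <= r) -> b <= cost_inf x.
Proof.
move=> h; apply: lb_le_inf; last by move=> r /h.
by have [r xr] := Rel_total x; exists r.
Qed.

Hypothesis Rel0 : Rel 0 0.
Hypothesis RelN : forall x r, Rel x r -> Rel (- x) r.
Hypothesis RelD : forall x y r s, Rel x r -> Rel y s -> Rel (x + y) (r + s).

Lemma cost_inf_seminorm : seminorm cost_inf.
Proof.
have le_N x : cost_inf x <= cost_inf (- x).
  by apply: cost_inf_ge => r /RelN; rewrite opprK; exact: cost_inf_le.
split=> [|x|x y].
- apply/eqP; rewrite eq_le cost_inf_le //=.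
  by apply: cost_inf_ge => r /Rel_ge0.
- by apply/eqP; rewrite eq_le le_N -{2}[x]opprK le_N.
- rewrite -lerBlDr; apply: cost_inf_ge => r xr.
  rewrite lerBlDr -lerBlDl; apply: cost_inf_ge => s ys.
  by rewrite lerBlDl; apply: cost_inf_le; exact: RelD.
Qed.

End Infimum.

Section NormOfMetric.
Context {R : realType} {G : zmodType}.
Implicit Types d : invariant_metrics R G.

Definition mnorm d (x : G) : R := idist d x 0.

Lemma idistE d x y : idist d x y = mnorm d (x - y).
Proof. by rewrite /mnorm -(idistDr d (- y)) subrr. Qed.

Lemma mnorm_seminorm d : seminorm (mnorm d).
Proof.
split=> [|x|x y]; first exact: idistxx.
  by rewrite /mnorm -{1}oppr0 idistN.
by have := idist_triangle d y (x + y) 0; rewrite (idistE _ _ y) addrK.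
Qed.

Lemma mnorm_eq0 d x : mnorm d x = 0 -> x = 0.
Proof. by move/idist_eq0. Qed.

Lemma invariant_metric_of_norm (p : G -> R) :
  seminorm p -> (forall x, p x = 0 -> x = 0) ->
  exists d : invariant_metrics R G, mnorm d = p.
Proof.
move=> sp p0.
pose f : G * G -> R := fun z => p (z.1 - z.2).
have fP : invariant_metrics R G f.
  split=> [a b|a b|a b c|a b c]; rewrite /f /=.
  - split=> [/p0/eqP|->]; first by rewrite subr_eq0 => /eqP.
    by rewrite subrr (seminorm0 sp).
  - exact: (seminormC sp).
  - exact: (seminorm_trans sp).
  - by rewrite opprD addrACA subrr addr0.
exists (exist _ f (mem_set fP)).
by apply/funext => x; rewrite -[LHS]/(p (x - 0)) subr0.
Qed.

End NormOfMetric.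

(** * Coordinates on a group isomorphic to its countable direct power *)

Section Coordinates.
Context {G : zmodType}.

(** The form in which the isomorphism with [direct_sum G] is used: independent copies of [G] inside
    [G], such that any finite set has zero component in all but finitely many of them. A copy
    avoiding a finite set serves as the second factor of [G * G]. *)
Record coordinates := Coordinates {
  cproj : nat -> {additive G -> G};
  cinj : nat -> {additive G -> G};
  cinjK : forall n, cancel (cinj n) (cproj n);
  cproj_cinj : forall m n x, m <> n -> cproj m (cinj n x) = 0;
  cproj_near0 : forall x, exists N, forall n, (N <= n)%N -> cproj n x = 0 }.

Lemma dsumD (x y : direct_sum G) n :
  dsum_val (x - y) n = dsum_val x n - dsum_val y n.
Proof. by rewrite -[dsum_val (x - y)]/(val (x - y)) raddfB. Qed.

Definition single (n : nat) (g : G) : nat -> G :=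
  fun m => if m == n then g else 0.

Lemma single_finitely_supported n g : single n g \in @finitely_supported G.
Proof.
rewrite inE; apply: (@sub_finite_set _ _ [set n]); last exact: finite_set1.
by move=> m /=; rewrite /single; case: (m =P n) => // _ /eqP.
Qed.

Definition dsum_inj n g : direct_sum G :=
  DirectSum (single_finitely_supported n g).

Lemma coordinates_exist :
  (exists f : {additive G -> direct_sum G}, bijective f) ->
  inhabited coordinates.
Proof.
case=> f [f' fK f'K].
have f'B : zmod_morphism f'.
  by move=> x y; apply: (can_inj fK); rewrite raddfB !f'K.
pose pr n (x : G) : G := dsum_val (f x) n.
pose ij n (x : G) : G := f' (dsum_inj n x).
have prB n : zmod_morphism (pr n) by move=> x y; rewrite /pr raddfB dsumD.
have ijB n : zmod_morphism (ij n).
  move=> x y; rewrite /ij -f'B; congr f'; apply: val_inj; apply/funext => m.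
  rewrite [RHS]dsumD /= /single; case: eqP => // _.
  by rewrite subr0.
pose prM n := GRing.isZmodMorphism.Build G G (pr n) (prB n).
pose ijM n := GRing.isZmodMorphism.Build G G (ij n) (ijB n).
pose prA n : {additive G -> G} := HB.pack (pr n) (prM n).
pose ijA n : {additive G -> G} := HB.pack (ij n) (ijM n).
constructor; apply: (@Coordinates prA ijA) => [n x|m n x mn|x] /=.
- by rewrite /pr /ij f'K /= /single eqxx.
- by rewrite /pr /ij f'K /= /single; case: eqP.
- rewrite /pr; case: (f x) => h hP /=.
  have /finite_seqP [s hs] : finite_set [set n | h n != 0].
    by move: hP; rewrite inE.
  exists (\max_(i <- s) i).+1 => n sn; apply/eqP/negPn/negP => hn.
  have : n \in s by have : [set n | h n != 0] n by []; rewrite hs.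
  by move=> ns; have := @leq_bigmax_seq _ s predT id n ns isT; rewrite leqNgt sn.
Qed.

End Coordinates.
Arguments coordinates : clear implicits.

(** * Generic metrics *)

(** The boundary of an open set is closed with empty interior, and the complement of the set in
    question is a countable union of such boundaries. *)
Lemma comeager_boundary_free (X : topologicalType) (I : countType)
    (O : I -> set X) :
  (forall i, open (O i)) ->
  comeager [set x | forall i, closure (O i) x -> O i x].
Proof.
move=> oO; pose bd i := closure (O i) `&` ~` O i.
have bd_nd i : nowhere_dense (bd i).
  have cbd : closed (bd i).
    by apply: closedI; [exact: closed_closure|exact: open_closedC].
  rewrite /nowhere_dense -(proj1 (closure_id _) cbd).
  rewrite -subset0 => x; rewrite /interior nbhsE /= => -[U [oU Ux] Ubd].
  have [/(_ U (open_nbhs_nbhs (conj oU Ux))) [y [Oy Uy]] _] := Ubd _ Ux.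
  by have [_ /(_ Oy)] := Ubd _ Uy.
exists (fun n => if unpickle n is Some i then bd i else set0); split.
  move=> n; case: (unpickle n) => [i|]; first exact: bd_nd.
  rewrite /nowhere_dense closure0; exact: interior0.
move=> x /= /existsNP [i /not_implyP [cx nx]].
by exists (pickle i) => //; rewrite pickleK.
Qed.

Section Generic.
Context {R : realType} {G : zmodType}.
Implicit Types d : invariant_metrics R G.

Lemma mnorm_continuous (t : G) :
  continuous (fun d : invariant_metrics R G => mnorm d t).
Proof.
move=> d; rewrite /mnorm /idist.
have h : continuous (fun f : {ptws G * G -> R} => f (t, 0)).
  exact: proj_continuous.
apply: (@continuous_comp _ _ _ (set_val : invariant_metrics R G -> {ptws G * G -> R})
   (fun f : {ptws G * G -> R} => f (t, 0))); last exact: h.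
exact: initial_continuous.
Qed.

(** The topology is pointwise convergence of metrics, and by invariance the value at [(a, b)] is the
    norm of [a - b]. *)
Lemma closure_mnorm (O : set (invariant_metrics R G)) d
    (u : nat -> invariant_metrics R G) :
  (forall n, O (u n)) ->
  (forall a, (fun n => mnorm (u n) a) @ \oo --> mnorm d a) -> closure O d.
Proof.
move=> Ou ucvg N [B [[B' oB' <-] /= B'd] BN].
have : {ptws, (fun n => set_val (u n)) @ \oo --> set_val d}.
  apply/cvg_sup => -[a b] N' [V [[W oW <-] /= Wd] WN']; apply: (filterS WN').
  have /ucvg [n0 _ hn] : nbhs (mnorm d (a - b)) W.
    by apply: open_nbhs_nbhs; split; rewrite -?idistE.
  exists n0 => // n /hn /=; rewrite -idistE; exact.
move=> /(_ B'); rewrite nbhsE => /(_ (ex_intro2 _ _ B' (conj oB' B'd) (fun _ => id))).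
case=> n _ /(_ n (leqnn n)) /= h.
by exists (u n); split => //; apply: BN.
Qed.

Definition satisfies d (c : seq (G * (rat * rat))) : Prop :=
  forall t, t \in c -> ratr t.2.1 < mnorm d t.1 < ratr t.2.2.

Lemma open_satisfies c : open [set d | satisfies d c].
Proof.
elim: c => [|t c ih].
  rewrite (_ : [set d | _] = setT); first exact: openT.
  by apply/seteqP; split => // d _ t; rewrite in_nil.
rewrite (_ : [set d | _] =
  (fun d => mnorm d t.1) @^-1` [set x | ratr t.2.1 < x] `&`
  ((fun d => mnorm d t.1) @^-1` [set x | x < ratr t.2.2] `&`
  [set d | satisfies d c])).
  apply: openI; last apply: openI ih.
  - apply: open_comp => [d _|]; [exact: mnorm_continuous|exact: open_gt].
  - apply: open_comp => [d _|]; [exact: mnorm_continuous|exact: open_lt].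
apply/seteqP; split=> [d h|d /= [h1 [h2 h]] s].
  have /andP [h1 h2] := h t (mem_head _ _).
  by split => //; split => // s sc; apply: h; rewrite inE sc orbT.
by rewrite inE => /orP [/eqP ->|/h //]; apply/andP.
Qed.

Definition solvable (W : Type) (c : W -> seq (G * (rat * rat))) :
  set (invariant_metrics R G) := [set d | exists w, satisfies d (c w)].

Lemma open_solvable W (c : W -> seq (G * (rat * rat))) : open (solvable c).
Proof.
rewrite (_ : solvable c = \bigcup_(w in setT) [set d | satisfies d (c w)]).
  by apply: bigcup_open => w _; exact: open_satisfies.
by apply/seteqP; split=> d [w]; [exists w|move=> _; exists w].
Qed.

Variable e : nat -> G.

(** The witness is a point together with a multiplier [w.2.+1], never zero. The lower bound -1 is
    vacuous for a norm, so the head only asks that the multiple have norm below [q]. Parameters are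
    named by their codes under [e], which keeps the conditions countable. *)
Definition point_constraints (s : seq (nat * (rat * rat))) (q : rat)
    (w : G * nat) : seq (G * (rat * rat)) :=
  (w.1 *+ w.2.+1, (-1, q)) :: [seq (e t.1 - w.1, t.2) | t <- s].

(** These prescribe, at finitely many pairs, the seminorm that [f] pulls back to [G * G] along the
    map sending [(a, h)] to [a + f h]. *)
Definition morphism_constraints (s : seq ((nat * nat) * (rat * rat)))
    (f : {additive G -> G}) : seq (G * (rat * rat)) :=
  [seq (e t.1.1 + f (e t.1.2), t.2) | t <- s].

Definition generic : set (invariant_metrics R G) :=
  [set d |
    (forall s q, closure (solvable (point_constraints s q)) d ->
       solvable (point_constraints s q) d) /\
    (forall s, closure (solvable (morphism_constraints s)) d ->
       solvable (morphism_constraints s) d)].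

Lemma comeager_generic : comeager generic.
Proof.
pose I := ((seq (nat * (rat * rat)) * rat) + seq ((nat * nat) * (rat * rat)))%type.
pose O (i : I) := match i with
  | inl sq => solvable (point_constraints sq.1 sq.2)
  | inr s => solvable (morphism_constraints s) end.
have -> : generic = [set d | forall i, closure (O i) d -> O i d].
  apply/seteqP; split=> [d [h1 h2] [[s q]|s] //=|d h]; [exact: h1|exact: h2|].
  by split=> [s q|s]; [exact: (h (inl (s, q)))|exact: (h (inr s))].
by apply: comeager_boundary_free => -[sq|s]; exact: open_solvable.
Qed.

Hypothesis e_surj : forall x, exists n, e n = x.

Lemma closure_near (O : set (invariant_metrics R G)) d :
  (forall (A : seq G) (eta : R), 0 < eta ->
    exists2 d', O d' & forall a, a \in A -> `|mnorm d' a - mnorm d a| <= eta) ->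
  closure O d.
Proof.
move=> h; pose A k := [seq e i | i <- iota 0 k].
have /choice [u hu] : forall k : nat, exists d', O d' /\
    forall a, a \in A k -> `|mnorm d' a - mnorm d a| <= k.+1%:R^-1.
  by move=> k; have [|d' ? ?] := h (A k) k.+1%:R^-1; [rewrite invr_gt0|exists d'].
apply: (@closure_mnorm _ _ u) => [n|a]; first by case: (hu n).
apply/cvgrPdist_le => eps eps0.
have [N _ hN] := near_infty_natSinv_lt (PosNum eps0).
have [i ia] := e_surj a.
exists (maxn N i.+1) => // n /=; rewrite geq_max => /andP [Nn ni].
rewrite distrC; have [_ /(_ a)] := hu n.
have aA : a \in A n by apply/mapP; exists i => //; rewrite mem_iota.
by move=> /(_ aA) /le_trans; apply; apply/ltW/hN.
Qed.

End Generic.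

Lemma countable_enum (G : zmodType) : countable [set: G] ->
  exists e : nat -> G, forall x, exists n, e n = x.
Proof.
move=> /countable_injP [f finj].
have /choice [e he] : forall n, exists x : G, forall y, f y = n -> x = y.
  move=> n; have [[x fx]|nx] := pselect (exists x, f x = n).
    by exists x => y fy; apply: finj; rewrite ?inE // fx fy.
  by exists 0 => y fy; case: nx; exists y.
by exists e => x; exists (f x); exact: he.
Qed.

Lemma finite_positive_bound (R : realType) (T : eqType) (F : seq T) (f : T -> R) :
  (forall x, x \in F -> 0 < f x) ->
  exists2 eta, 0 < eta & forall x, x \in F -> eta <= f x.
Proof.
elim: F => [_|x F ih h]; first by exists 1.
have [y yF|eta eta0 heta] := ih; first by rewrite h // inE yF orbT.
exists (Num.min eta (f x)); first by rewrite lt_min eta0 h ?mem_head.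
by move=> y; rewrite inE ge_min => /orP [/eqP ->|/heta ->]; rewrite ?lexx ?orbT.
Qed.

Lemma finite_upper_bound (R : realType) (T : eqType) (F : seq T) (f : T -> R) :
  exists2 C, 0 <= C & forall x, x \in F -> f x <= C.
Proof.
elim: F => [|x F [C C0 hC]]; first by exists 0.
exists (Num.max C (f x)); first by rewrite le_max C0.
by move=> y; rewrite inE le_max => /orP [/eqP ->|/hC ->]; rewrite ?lexx ?orbT.
Qed.

(** * Realising amalgams by norms close to a given one *)

Section Density.
Context {R : realType} {G : zmodType} (c : coordinates G).

Lemma cproj_eventually0 (A : seq G) :
  exists n, forall a, a \in A -> cproj c n a = 0.
Proof.
have [N hN] : exists N, forall a n, a \in A -> (N <= n)%N -> cproj c n a = 0.
  elim: A => [|a A [N hN]]; first by exists 0%N.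
  have [N' hN'] := cproj_near0 c a; exists (maxn N N') => b n.
  rewrite inE geq_max => /orP [/eqP ->|bA] /andP [n1 n2]; first exact: hN'.
  exact: hN.
by exists N => a aA; exact: hN.
Qed.

(** Choose a coordinate [n] vanishing on [A]. Splitting off the [n]-th component is a homomorphism
    from [G] to [G * G] which sends [a + cinj c n h] to [(a, h)] for [a] in [A]. The seminorm [nu]
    is pulled back along it, and [eta] times the discrete norm is added to make it positive. *)
Lemma realize_seminorm (nu : G * G -> R) (A : seq G) (eta : R) :
  seminorm nu -> 0 < eta ->
  exists (n : nat) (d : invariant_metrics R G),
    forall a h, a \in A -> `|mnorm d (a + cinj c n h) - nu (a, h)| <= eta.
Proof.
move=> snu eta0; have [n hn] := cproj_eventually0 A.
pose p x := nu (x - cinj c n (cproj c n x), cproj c n x) + eta * (x != 0)%:R.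
have sp : seminorm p.
  split=> [|x|x y]; rewrite /p.
  - rewrite !raddf0 addr0 -[(0, 0)]/(0 : G * G) (seminorm0 snu) eqxx /=.
    by rewrite mulr0 addr0.
  - rewrite (raddfN (cproj c n)) (raddfN (cinj c n)) oppr_eq0.
    congr (_ + _); rewrite -[RHS](seminormN snu); congr nu.
    by rewrite -[RHS]/(- _, - _) /= opprK opprB addrC.
  - rewrite addrACA lerD //; last first.
      rewrite -mulrDr ler_pM2l // -natrD ler_nat.
      case: (eqVneq x 0) => [->|_]; first by rewrite add0r.
      by rewrite (leq_trans (leq_b1 _)).
    rewrite (raddfD (cproj c n)) (raddfD (cinj c n)).
    apply: le_trans (seminormD snu _ _).
    by rewrite -[(_, _) + (_, _)]/(_ + _, _ + _) /= opprD addrACA.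
have p0 x : p x = 0 -> x = 0.
  move=> px; apply/eqP/negPn/negP => x0.
  have := seminorm_ge0 snu (x - cinj c n (cproj c n x), cproj c n x).
  by move: px; rewrite /p x0 mulr1; lra.
have [d dE] := invariant_metric_of_norm sp p0.
exists n, d => a h aA; rewrite dE /p raddfD /= hn // cinjK add0r addrK.
rewrite addrAC subrr add0r ger0_norm; last by rewrite mulr_ge0 ?ler0n ?ltW.
by rewrite ler_piMr ?lern1 ?leq_b1 ?ltW.
Qed.

Lemma rat_interval (x eps : R) : 0 < eps ->
  exists p q : rat, [/\ ratr p < x, x < ratr q, x - eps < ratr p & ratr q < x + eps].
Proof.
move=> e0.
have [p] : exists p, ratr p \in `](x - eps), x[.
  by apply: rat_in_itvoo; lra.
have [q] : exists p, ratr p \in `]x, (x + eps)[.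
  by apply: rat_in_itvoo; lra.
rewrite !in_itv /= => /andP [? ?] /andP [? ?].
by exists p, q.
Qed.

Variable e : nat -> G.
Hypothesis e_surj : forall x, exists n, e n = x.

(** The wanted values of [nu] are enclosed in narrow rational intervals. Realisations of [nu]
    satisfy the resulting condition, and they converge to [d] because [nu] extends [mnorm d]; so [d]
    lies in the closure of an open set of the list and, being generic, in the set itself. *)
Lemma generic_amalgam (d : invariant_metrics R G) (nu : G * G -> R)
    (F : seq (G * G)) (eps : R) :
  generic e d -> seminorm nu -> (forall a, nu (a, 0) = mnorm d a) -> 0 < eps ->
  exists f : {additive G -> G},
    forall x, x \in F -> `|mnorm d (x.1 + f x.2) - nu x| < eps.
Proof.
move=> [_ dgen] snu nud eps0.
have /choice [b hb] : forall x : G * G, exists b : (nat * nat) * (rat * rat),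
   [/\ e b.1.1 = x.1, e b.1.2 = x.2, ratr b.2.1 < nu x < ratr b.2.2,
       nu x - eps < ratr b.2.1 & ratr b.2.2 < nu x + eps].
  move=> [g h]; have [i ig] := e_surj g; have [j jh] := e_surj h.
  have [p [q [? ? ? ?]]] := rat_interval (nu (g, h)) eps0.
  by exists ((i, j), (p, q)); split => //; apply/andP.
pose s := map b F.
(* An error of at most half the least margin keeps every value inside its open interval. *)
pose margin x := Num.min (nu x - ratr (b x).2.1) (ratr (b x).2.2 - nu x).
have [|eta eta0 heta] := @finite_positive_bound R _ F margin.
  move=> x _; have [_ _ /andP [h1 h2] _ _] := hb x.
  by rewrite /margin lt_min !subr_gt0 h1.
have : closure (solvable (morphism_constraints e s)) d.
  apply: closure_near => // A dl dl0.
  have m0 : 0 < Num.min dl (eta / 2) by rewrite lt_min dl0 divr_gt0.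
  have [n [d' hd']] := realize_seminorm (A ++ [seq x.1 | x <- F]) snu m0.
  exists d' => [|a aA]; last first.
    have := hd' a 0; rewrite mem_cat aA raddf0 addr0 nud => /(_ isT)/le_trans; apply.
    by rewrite ge_min lexx.
  exists (cinj c n) => t /mapP [_ /mapP [x xF ->] ->] /=.
  have [-> -> _ _ _] := hb x.
  have := heta _ xF; rewrite /margin le_min => /andP [h1 h2].
  have := hd' x.1 x.2; rewrite mem_cat map_f // orbT => /(_ isT).
  rewrite -surjective_pairing => /le_trans h.
  have : `|mnorm d' (x.1 + cinj c n x.2) - nu x| <= eta / 2.
    by apply: h; rewrite ge_min lexx orbT.
  by rewrite ler_norml => /andP [? ?]; apply/andP; split; lra.
move=> /dgen [f hf]; exists f => x xF.
have /hf : (e (b x).1.1 + f (e (b x).1.2), (b x).2) \in morphism_constraints e s f.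
  by apply/mapP; exists (b x) => //; exact: map_f.
have [-> -> _ h3 h4] /= := hb x; move=> /andP [? ?].
by rewrite ltr_norml; apply/andP; split; lra.
Qed.

End Density.

(** * One-point extensions: finite Katetov functions, given by their graphs *)

Definition katetov (R : realType) (T : choiceType) (D : T -> T -> R)
    (s : seq (T * R)) : Prop :=
  forall p q, p \in s -> q \in s -> p.2 - q.2 <= D p.1 q.1 <= p.2 + q.2.

Section KatetovSeminorm.
Context {R : realType} {G : zmodType}.
Variables (p : G -> R) (s : seq (G * R)) (m C : R) (z : G) (N : nat).
Hypotheses (sp : seminorm p) (ks : katetov (fun x y => p (x - y)) s).
Hypotheses (m_gt0 : 0 < m) (m_le : forall t, t \in s -> m <= t.2).
Hypotheses (C_ge0 : 0 <= C) (s_le : forall t, t \in s -> t.2 <= C).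
Hypotheses (N_gt0 : (0 < N)%N) (C_le : C <= m * N.-1%:R).
Hypothesis z_order : forall i j, z *+ i = z *+ j -> i = j %[mod N].

Let pts (u : seq (G * R)) : G := \sum_(t <- u) t.1.
Let cost (u : seq (G * R)) : R := \sum_(t <- u) t.2.

Let cost_ge u : all (mem s) u -> m * (size u)%:R <= cost u.
Proof.
rewrite /cost; elim: u => [|t u ih] /=; first by rewrite big_nil mulr0.
move=> /andP [/m_le tm /ih]; rewrite big_cons -natr1 mulrDr mulr1; lra.
Qed.

Let cost_ge0 u : all (mem s) u -> 0 <= cost u.
Proof. by move=> /cost_ge; apply: le_trans; rewrite mulr_ge0 // ltW. Qed.

(** The letters are cancelled in pairs, one from each list, and the upper Katetov inequality
    [p (a.1 - b.1) <= a.2 + b.2] pays for each pair. *)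
Let balanced u v g : size u = size v -> all (mem s) u -> all (mem s) v ->
  p g <= p (g - pts u + pts v) + cost u + cost v.
Proof.
rewrite /pts /cost; elim: u v g => [|a u ih] [|b v] g //=.
  by rewrite !big_nil subr0 !addr0.
move=> [/ih h] /andP [sa /h {}h] /andP [sb /(h (g - a.1 + b.1)) {}h].
rewrite !big_cons; have /andP [_] := ks sa sb.
have := seminormD sp (g - a.1 + b.1) (a.1 - b.1).
rewrite (_ : g - a.1 + b.1 + _ = g); last by rewrite addrA (addrAC _ b.1) subrK addrK.
rewrite (_ : g - (a.1 + _) + _ = g - a.1 + b.1 - (\sum_(t <- u) t.1) +
  \sum_(t <- v) t.1); last by rewrite opprD !addrA (addrAC _ _ b.1).
lra.
Qed.

Let total g u v : R := p (g - pts u + pts v) + cost u + cost v.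

(* The generators are the points [(t.1, - z)] at cost [t.2], for [t] in [s],
   their opposites, the points [(g, 0)] at cost [p g], and [(0, z *+ N)] at no
   cost; [C] caps the cost. *)
Let Rel (x : G * G) (r : R) : Prop :=
  C <= r \/ exists u v i j, [/\ all (mem s) u, all (mem s) v,
    x.2 + z *+ (size u + N * i) = z *+ (size v + N * j) &
    total x.1 u v <= r].

(** The new point is [(0, z)]. Reaching [(a, 0)] takes equally many positive and negative generators
    modulo [N], and reaching [(t.1, - z)] one more positive than negative. If this holds exactly,
    the Katetov inequalities show that nothing is gained: [balanced] cancels pairs, and the lower
    inequality handles the remaining letter. If it holds only modulo [N], at least [N.-1] generators
    of cost at least [m] are used, which already costs [C]. The cap makes every pair reachable, at
    the price of truncating [p] at [C]. *)
Lemma katetov_seminorm : exists nu : G * G -> R, [/\ seminorm nu,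
  forall a, p a <= C -> nu (a, 0) = p a,
  forall t, t \in s -> nu (t.1, - z) = t.2 & nu (0, z *+ N) = 0].
Proof.
have Rel_ge0 x r : Rel x r -> 0 <= r.
  case=> [|[u [v [i [j [su sv _]]]]]]; first exact: le_trans.
  by apply: le_trans; rewrite /total !addr_ge0 ?cost_ge0 // (seminorm_ge0 sp).
have Rel_total x : exists r, Rel x r by exists C; left.
have Rel00 g : Rel (g, 0) (p g).
  right; exists [::], [::], 0%N, 0%N; split => //=; first by rewrite add0r.
  by rewrite /total /pts /cost !big_nil subr0 !addr0.
have ptsU u v : pts (u ++ v) = pts u + pts v by rewrite /pts big_cat.
have costU u v : cost (u ++ v) = cost u + cost v by rewrite /cost big_cat.
(* Dichotomy: the lengths, even after adding one, are below [N] and hence determined by their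
   residues, or the cost is at least [C]. *)
have small u v : (size u + size v < N.-1)%N -> [/\ (size u < N)%N,
    (size v < N)%N & ((size v).+1 < N)%N].
  move: (size u) (size v) => i j h; split; lia.
have far u v r : all (mem s) u -> all (mem s) v ->
    (N.-1 <= size u + size v)%N -> C <= p r + cost u + cost v.
  move=> su sv h; have := cost_ge su; have := cost_ge sv.
  have := seminorm_ge0 sp r; have h2 : m * N.-1%:R <= m * (size u + size v)%:R.
    by rewrite ler_pM2l // ler_nat.
  by move: h2; rewrite natrD mulrDr; have := C_le; lra.
exists (cost_inf Rel); split.
- apply: cost_inf_seminorm => //; first by have := Rel00 0; rewrite (seminorm0 sp).
    move=> x r [Cr|[u [v [i [j [su sv h le_r]]]]]]; first by left.
    right; exists v, u, j, i; split => //=; first by rewrite -h addKr.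
    apply: le_trans le_r; rewrite /total -(seminormN sp) -!addrA (addrC (cost u)).
    by rewrite lerD2r !opprD !opprK addrA addrAC addrA.
  move=> x y r1 r2 xr yr.
  have r10 := Rel_ge0 _ _ xr; have r20 := Rel_ge0 _ _ yr.
  case: xr => [Cr|[u [v [i [j [su sv h le_r1]]]]]]; first by left; lra.
  case: yr => [Cr|[u' [v' [i' [j' [su' sv' h' le_r2]]]]]]; first by left; lra.
  right; exists (u ++ u'), (v ++ v'), (i + i')%N, (j + j')%N.
  rewrite !all_cat su su' sv sv' !size_cat; split => //.
    by rewrite !mulnDr 2!(addnACA _ _ (N * _)%N) (mulrnDr z (size u + _)%N)
      (mulrnDr z (size v + _)%N) /= addrACA h h'.
  rewrite /total !ptsU !costU; move: le_r1 le_r2; rewrite /total.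
  have := seminormD sp (x.1 - pts u + pts v) (y.1 - pts u' + pts v').
  by rewrite addrACA (addrACA x.1) -opprD -[(x + y).1]/(x.1 + y.1); lra.
- move=> a aC; apply/eqP; rewrite eq_le cost_inf_le //=.
  apply: cost_inf_ge => // r [|[u [v [i [j [su sv /= h]]]]]]; first exact: le_trans.
  apply: le_trans; have [uv|uv] := eqVneq (size u) (size v); first exact: balanced.
  apply: (le_trans aC); apply: far => //.
  rewrite leqNgt; apply/negP => /small [uN vN vN'].
  move: h; rewrite add0r => /z_order; rewrite !(mulnC N) !(addnC (size _)) !modnMDl.
  by rewrite !modn_small // => /eqP; rewrite (negPf uv).
- move=> t ts; apply/eqP; rewrite eq_le; apply/andP; split.
    apply: cost_inf_le => //; right; exists [:: t], [::], 0%N, 0%N.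
    rewrite /= ts muln0 addn0 mulr1n addNr; split => //.
    by rewrite /total /pts /cost !big_seq1 !big_nil subrr !addr0 (seminorm0 sp) add0r.
  apply: cost_inf_ge => // r [|[u [v [i [j [su sv /= h]]]]]].
    by apply: le_trans; exact: s_le.
  apply: le_trans; have [uv|uv] := eqVneq (size u) (size v).+1.
    case: u su uv {h} => [//|a u] /= /andP [sa su] [uv].
    have := balanced (t.1 - a.1) uv su sv; have /andP [+ _] := ks ts sa.
    by rewrite /total /pts /cost !big_cons opprD (addrA t.1); lra.
  apply: (le_trans (s_le ts)); apply: far => //.
  rewrite leqNgt; apply/negP => /small [uN vN vN'].
  have {}h : z *+ (size u + N * i) = z *+ ((size v).+1 + N * j).
    by rewrite addSn mulrS -h addrA subrr add0r.
  move/z_order: h; rewrite !(mulnC N) !(addnC (size _)) !(addnC _.+1) !modnMDl.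
  by rewrite !modn_small // => /eqP; rewrite (negPf uv).
- apply/eqP; rewrite eq_le; apply/andP; split; last first.
    by apply: cost_inf_ge => // r /Rel_ge0.
  apply: cost_inf_le => //; right; exists [::], [::], 0%N, 1%N.
  split => //=; first by rewrite muln0 muln1 addr0.
  by rewrite /total /pts /cost !big_nil subr0 !addr0 (seminorm0 sp).
Qed.

End KatetovSeminorm.

(** An element of infinite order serves for every [N], and one of order [N] for that [N]; so both
    cases of unboundedness give the same property. *)
Lemma element_of_large_order (G : zmodType) (N0 : nat) : unbounded_group G ->
  exists (z : G) (N : nat), [/\ (N0 <= N)%N, (0 < N)%N &
    forall i j, z *+ i = z *+ j -> i = j %[mod N]].
Proof.
move=> ubG; have [z [N [N0N N_gt0 hz]]] : exists (z : G) (N : nat),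
    [/\ (N0 <= N)%N, (0 < N)%N & forall k, z *+ k = 0 -> (N %| k)%N].
  case: ubG => [[z hz]|/(_ N0) [z [N [N0N [N_gt0 zN hz]]]]].
    exists z, N0.+1; split=> // -[|k] // zk.
    by case: (hz k.+1 isT).
  exists z, N; split=> // k zk; apply/negPn/negP; rewrite /dvdn -lt0n => kN.
  apply: (hz (k %% N)%N); first by rewrite kN ltn_mod.
  by move: zk; rewrite {1}(divn_eq k N) mulrnDr mulnC mulrnA zN mul0rn add0r.
exists z, N; split => // i j; wlog ij : i j / (i <= j)%N.
  by move=> h; have [/h //|/ltnW /h h' /esym/h' ->] := leqP i j.
move=> zij; apply/eqP; rewrite eq_sym eqn_mod_dvd //; apply: hz.
by rewrite mulrnBr // zij subrr.
Qed.

Section PointExtension.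
Context {R : realType} {G : zmodType} (c : coordinates G) (e : nat -> G).
Hypothesis e_surj : forall x, exists n, e n = x.
Hypothesis unbounded_G : unbounded_group G.
Variable d : invariant_metrics R G.
Hypothesis dgen : generic e d.

Lemma point_extension (s : seq (G * R)) (eps : R) :
  katetov (fun x y => mnorm d (x - y)) s -> (forall t, t \in s -> 0 < t.2) ->
  0 < eps ->
  exists (x : G) (L : nat), [/\ (0 < L)%N, mnorm d (x *+ L) < eps &
    forall t, t \in s -> `|mnorm d (t.1 - x) - t.2| < eps].
Proof.
move=> ks s_gt0 eps0; have sd := mnorm_seminorm d.
have /choice [b hb] : forall t : G * R, exists b : nat * (rat * rat),
   [/\ e b.1 = t.1, ratr b.2.1 < t.2 < ratr b.2.2,
       t.2 - eps < ratr b.2.1 & ratr b.2.2 < t.2 + eps].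
  move=> [g r]; have [i ig] := e_surj g.
  have [p [q [? ? ? ?]]] := rat_interval r eps0.
  by exists (i, (p, q)); split => //; apply/andP.
(* All that is wanted is a rational [q0] strictly between 0 and [eps]. *)
have [q0 [_ [q0_gt0 _ _ q0_lt]]] : exists q0 q1 : rat, [/\ 0 < ratr q0 :> R,
    (0 : R) < ratr q1, eps - eps < ratr q0 :> R & ratr q0 < eps].
  have [p [q [h1 h2 h3 h4]]] : exists p q : rat, [/\ ratr p < eps / 2,
      eps / 2 < ratr q, eps / 2 - eps / 2 < ratr p & ratr q < eps / 2 + eps / 2 :> R].
    by apply: rat_interval; rewrite divr_gt0.
  by exists q, q; split; lra.
pose margin t := Num.min (t.2 - ratr (b t).2.1) (ratr (b t).2.2 - t.2).
have [|eta eta0 heta] := @finite_positive_bound R _ s margin.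
  move=> t _; have [_ /andP [h1 h2] _ _] := hb t.
  by rewrite /margin lt_min !subr_gt0 h1.
have [m m0 hm] := finite_positive_bound s_gt0.
have : closure (solvable (point_constraints e (map b s) q0)) d.
  apply: closure_near => // A dl dl0.
  have [C1 C10 hC1] := finite_upper_bound A (mnorm d).
  have [C2 C20 hC2] := finite_upper_bound s snd.
  (* The cap lies above the norms on [A], where closeness to [d] is tested, and above the prescribed
     distances. *)
  pose C := C1 + C2; have C0 : 0 <= C by rewrite addr_ge0.
  have [K hK] : exists K : nat, C <= m * K%:R.
    have [K _ hK] := nbhs_infty_ger (C / m); exists K.
    by have := hK K (leqnn K); rewrite /= ler_pdivrMr // mulrC.
  have [z [N [KN N0 hz]]] := element_of_large_order K.+1 unbounded_G.
  have C_le : C <= m * N.-1%:R.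
    by apply: (le_trans hK); rewrite ler_pM2l // ler_nat; case: N KN {N0 hz}.
  have [|nu [snu nuA nus nuN]] := katetov_seminorm sd ks m0 hm C0 _ N0 C_le hz.
    by move=> t /hC2 h; apply: (le_trans h); rewrite /C lerDr.
  have mu0 : 0 < Num.min (Num.min dl (eta / 2)) (ratr q0 / 2).
    by rewrite !lt_min dl0 (divr_gt0 eta0) //= divr_gt0.
  have [n [d' hd']] := realize_seminorm c (0 :: A ++ [seq t.1 | t <- s]) snu mu0.
  have {}hd' a h : a \in 0 :: A ++ [seq t.1 | t <- s] ->
     [/\ `|mnorm d' (a + cinj c n h) - nu (a, h)| <= dl,
       `|mnorm d' (a + cinj c n h) - nu (a, h)| <= eta / 2 &
       `|mnorm d' (a + cinj c n h) - nu (a, h)| <= ratr q0 / 2].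
    by move=> /(hd' a h); rewrite !le_min => /andP [/andP [-> ->] ->].
  exists d' => [|a aA]; last first.
    have := hd' a 0; rewrite inE mem_cat aA orbT raddf0 addr0 => /(_ isT) [+ _ _].
    rewrite nuA //; apply: (le_trans (hC1 _ aA)); by rewrite /C lerDl.
  (* The multiplier [N.-1.+1] is [N], and [nu] vanishes at [(0, z *+ N)]. *)
  exists (cinj c n z, N.-1) => t; rewrite inE => /orP [/eqP -> /=|].
    have [//|_ _] := hd' 0 (z *+ N); first by rewrite mem_head.
    rewrite prednK // nuN add0r raddfMn subr0 ler_norml => /andP [h1 h2].
    have h3 := seminorm_ge0 (mnorm_seminorm d') (cinj c n z *+ N).
    by rewrite rmorphN1; apply/andP; split; lra.
  move=> /mapP [_ /mapP [x xs ->] ->] /=; have [-> _ _ _] := hb x.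
  have := heta _ xs; rewrite /margin le_min => /andP [h1 h2].
  have [|_ + _] := hd' x.1 (- z); first by rewrite inE mem_cat map_f ?orbT.
  by rewrite nus // raddfN ler_norml => /andP [? ?]; apply/andP; split; lra.
move=> /(proj1 dgen) [[x L] /= hx]; exists x, L.+1; split => //.
  have /andP [_ h] := hx (x *+ L.+1, (-1, q0)) (mem_head _ _).
  exact: lt_trans q0_lt.
move=> t ts; have [et _ h3 h4] := hb t.
have /hx /= : (e (b t).1 - x, (b t).2) \in point_constraints e (map b s) q0 (x, L).
  by rewrite inE; apply/orP; right; apply/mapP; exists (b t) => //; exact: map_f.
by rewrite et => /andP [? ?]; rewrite ltr_norml; apply/andP; split; lra.
Qed.

(** Take [y] at distance about [eps / 3] from [x] with a multiple [y *+ L] of small norm, and write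
    [x *+ L] as [(x - y) *+ L + y *+ L]. *)
Lemma slow_growth (x : G) (eps : R) : 0 < eps ->
  exists q, (0 < q)%N /\ mnorm d (x *+ q) <= eps * q%:R.
Proof.
move=> eps0; have sd := mnorm_seminorm d.
have e20 : 0 < eps / 3 by rewrite divr_gt0.
have [|t|y [L [L0 yL]]] := @point_extension [:: (x, eps / 3)] _ _ _ e20.
- move=> s t; rewrite !inE => /eqP -> /eqP -> /=.
  by rewrite !subrr (seminorm0 sd) lexx /= addr_ge0 ?ltW.
- by rewrite inE => /eqP ->.
move=> /(_ (x, eps / 3) (mem_head _ _)) /=; rewrite ltr_norml => /andP [_ xy].
exists L; split => //.
have -> : x *+ L = (x - y) *+ L + y *+ L by rewrite -mulrnDl subrK.
have L1 : 1 <= L%:R :> R by rewrite ler1n.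
have h1 := seminormD sd ((x - y) *+ L) (y *+ L).
have h2 := seminorm_mulrn sd (x - y) L; rewrite -mulr_natr in h2.
have h3 : mnorm d (x - y) * L%:R <= (eps / 3 + eps / 3) * L%:R.
  by rewrite ler_pM2r ?ltr0n // ltW //; lra.
have h4 : eps / 3 <= eps / 3 * L%:R by rewrite ler_pMr.
have -> : eps * L%:R = (eps / 3 + eps / 3) * L%:R + eps / 3 * L%:R.
  by rewrite -mulrDl; congr (_ * _); field.
lra.
Qed.

End PointExtension.

(** * Uniqueness of the generic completion *)

Section Words.
Context {R : realType} {G : zmodType}.
Implicit Types (S u : seq G) (p : G -> R).

Definition slow p : Prop :=
  forall x eps, 0 < eps -> exists q, (0 < q)%N /\ p (x *+ q) <= eps * q%:R.

(** Divide [n] by a [q] whose multiple is short; the remainder only contributes a bounded term. *)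
Lemma slow_multiples p x eps : seminorm p -> slow p -> 0 < eps ->
  exists2 M, 0 <= M & forall n, p (x *+ n) <= eps * n%:R + M.
Proof.
move=> sp slp eps0; have [q [q0 xq]] := slp x _ eps0.
have px := seminorm_ge0 sp x.
exists (p x * q%:R) => [|n]; first by rewrite mulr_ge0.
rewrite {1}(divn_eq n q) mulrnDr mulnC mulrnA.
have h1 := seminormD sp (x *+ q *+ (n %/ q)) (x *+ (n %% q)).
have h2 := seminorm_mulrn sp (x *+ q) (n %/ q).
have h3 := seminorm_mulrn sp x (n %% q).
have h4 : p (x *+ q) *+ (n %/ q) <= eps * n%:R.
  rewrite -(mulr_natr (p _)); apply: (@le_trans _ _ (eps * q%:R * (n %/ q)%:R)).
    by rewrite ler_wpM2r.
  by rewrite -mulrA -natrM ler_pM2l // ler_nat mulnC leq_divM.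
have h5 : p x *+ (n %% q) <= p x * q%:R.
  by rewrite -(mulr_natr (p _)) ler_wpM2l // ler_nat ltnW // ltn_mod.
lra.
Qed.

(** By commutativity equal letters can be collected into multiples. *)
Lemma slow_words p S eps : seminorm p -> slow p -> 0 < eps ->
  exists2 M, 0 <= M &
    forall u, all (mem S) u -> p (\sum_(x <- u) x) <= eps * (size u)%:R + M.
Proof.
move=> sp slp eps0; elim: S => [|s S [M M0 ih]].
  exists 0 => // -[|//] _; by rewrite big_nil (seminorm0 sp) mulr0 addr0.
have [M' M'0 hs] := slow_multiples s sp slp eps0.
exists (M' + M) => [|u /allP uS]; first by rewrite addr_ge0.
rewrite (bigID (pred1 s)) /= -[X in _ + X]big_filter.
have -> : \sum_(x <- u | x == s) x = s *+ count (pred1 s) u.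
  by rewrite (eq_bigr (fun=> s)) => [|x /eqP //]; rewrite big_const_seq iter_addr addr0.
have /ih h : all (mem S) [seq x <- u | x != s].
  apply/allP => x; rewrite mem_filter => /andP [xs /uS].
  by rewrite /= inE (negPf xs).
have -> : (size u)%:R = (count (pred1 s) u)%:R + (size [seq x <- u | x != s])%:R :> R.
  by rewrite -natrD size_filter count_predC.
have h1 := seminormD sp (s *+ count (pred1 s) u) (\sum_(x <- u | x != s) x).
rewrite -big_filter in h1; rewrite mulrDr; have := hs (count (pred1 s) u); lra.
Qed.

Fixpoint word_sums S n : seq G :=
  if n is n'.+1 then
    word_sums S n' ++ [seq s + x | s <- S, x <- word_sums S n']
  else [:: 0].

Lemma mem_word_sums S n u : all (mem S) u -> (size u <= n)%N ->
  \sum_(x <- u) x \in word_sums S n.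
Proof.
elim: n u => [|n ih] [|a u] //=; rewrite ?big_nil ?mem_head //.
  by move=> _ _; rewrite mem_cat; have := ih [::] isT isT; rewrite big_nil => ->.
move=> /andP [aS uS] un; rewrite big_cons mem_cat; apply/orP; right.
by apply/allpairsP; exists (a, \sum_(x <- u) x); split => //; exact: ih.
Qed.

(* A bound on the words of one large length propagates to all longer words by
   cutting them into blocks. *)
Lemma uniform_growth p S eps : seminorm p -> slow p -> 0 < eps ->
  exists T, forall mu, seminorm mu ->
    (forall x, x \in word_sums S T -> mu x <= p x + 1) ->
    forall u, all (mem S) u -> (T <= size u)%N ->
      mu (\sum_(x <- u) x) <= eps * (size u)%:R.
Proof.
move=> sp slp eps0; have e40 : 0 < eps / 4 by rewrite divr_gt0.
have [M M0 hM] := slow_words S sp slp e40.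
(* [T] absorbs the additive constant of [slow_words] and the tolerance 1 allowed to [mu]. It is
   fixed before [mu], so only finitely many values of [mu] are ever tested. *)
have [T T0 hT] : exists2 T : nat, (0 < T)%N & M + 1 <= eps / 4 * T%:R.
  have [K _ hK] := nbhs_infty_ger ((M + 1) / (eps / 4)); exists K.+1 => //.
  have /= := hK K.+1 (leqnSn K); by rewrite ler_pdivrMr // mulrC.
exists T => mu smu hmu.
have short u : all (mem S) u -> (size u <= T)%N ->
    mu (\sum_(x <- u) x) <= eps / 4 * ((size u)%:R + T%:R).
  move=> uS uT; have := hmu _ (mem_word_sums uS uT); have := hM _ uS.
  by rewrite mulrDr; lra.
have long n u : (size u <= n)%N -> all (mem S) u ->
    mu (\sum_(x <- u) x) <= eps / 2 * ((size u)%:R + T%:R).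
  elim: n u => [|n ih] u un uS; have [uT|Tu] := leqP (size u) T.
  - have := short u uS uT; have : 0 <= eps * ((size u)%:R + T%:R).
      by rewrite mulr_ge0 ?addr_ge0 ?ler0n // ltW.
    lra.
  - by move: (leq_trans Tu un); rewrite ltn0.
  - have := short u uS uT; have : 0 <= eps * ((size u)%:R + T%:R).
      by rewrite mulr_ge0 ?addr_ge0 ?ler0n // ltW.
    lra.
  move: uS; rewrite -{1}(cat_take_drop T u) all_cat => /andP [u1S u2S].
  have s1 : size (take T u) = T by rewrite size_take Tu.
  have s2 : (size u)%:R = T%:R + (size (drop T u))%:R :> R.
    by rewrite -natrD size_drop subnKC // ltnW.
  (* A full block costs at most [eps / 4 * (T + T)], which is its share [eps / 2 * T] of the
     budget. *)
  have := short _ u1S; rewrite s1 => /(_ (leqnn _)) h1.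
  have h2 : mu (\sum_(x <- drop T u) x) <= eps / 2 * ((size (drop T u))%:R + T%:R).
    by apply: ih u2S; rewrite size_drop; lia.
  rewrite -{1}(cat_take_drop T u) big_cat /= s2.
  have := seminormD smu (\sum_(x <- take T u) x) (\sum_(x <- drop T u) x).
  rewrite !mulrDr; rewrite !mulrDr in h1 h2; lra.
move=> u uS Tu; have := long _ u (leqnn _) uS; rewrite mulrDr.
have : eps / 2 * T%:R <= eps / 2 * (size u)%:R.
  by rewrite ler_pM2l ?divr_gt0 // ler_nat.
lra.
Qed.

(** An error proportional to the length of the word is what gluing at a cost of [eps] per letter can
    tolerate. *)
Definition word_isometry p p' (f : G -> G) S (eps : R) : Prop :=
  forall u, all (mem S) u ->
    `|p' (f (\sum_(x <- u) x)) - p (\sum_(x <- u) x)| <= eps * (size u)%:R.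

(** Words of length at least [T] are short for both [p] and [p' \o f] by [uniform_growth], so the
    two values differ little; nonempty shorter words are tested directly. The requirement on all
    words is thereby reduced to finitely many values, within reach of [generic_amalgam]. *)
Lemma word_isometry_of_close p p' S eps :
  seminorm p -> seminorm p' -> slow p -> 0 < eps ->
  exists T, forall f : {additive G -> G},
    (forall x, x \in word_sums S T -> `|p' (f x) - p x| <= Num.min eps 1) ->
    word_isometry p p' f S eps.
Proof.
move=> sp sp' slp eps0; have [T hT] := uniform_growth S sp slp eps0.
exists T => f hf u uS.
have sf : seminorm (p' \o f).
  split=> [|x|x y] /=; first by rewrite raddf0 (seminorm0 sp').
    by rewrite raddfN (seminormN sp').
  by rewrite raddfD (seminormD sp').
have [Tu|uT] := leqP T (size u).
  have h1 : p (\sum_(x <- u) x) <= eps * (size u)%:R.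
    by apply: hT => // x _; rewrite lerDl.
  have h2 : (p' \o f) (\sum_(x <- u) x) <= eps * (size u)%:R.
    apply: hT => // x /hf /=; rewrite le_min => /andP [_].
    by rewrite ler_norml => /andP [_]; lra.
  rewrite /= in h2.
  have := seminorm_ge0 sp (\sum_(x <- u) x).
  have := seminorm_ge0 sp' (f (\sum_(x <- u) x)).
  by rewrite ler_norml => *; apply/andP; split; lra.
case: u uS uT => [|a u] uS uT.
  by rewrite big_nil raddf0 (seminorm0 sp) (seminorm0 sp') subrr normr0 mulr0.
have := hf _ (mem_word_sums uS (ltnW uT)); rewrite le_min => /andP [h _].
apply: (le_trans h); by rewrite ler_pMr // ler1n.
Qed.

(** * Gluing two copies of the group along a morphism *)

Definition symmetric_seq S : Prop := forall x, x \in S -> - x \in S.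

Section Amalgam.
Variables (p p' : G -> R) (f : {additive G -> G}) (S : seq G) (eps : R).
Hypotheses (sp : seminorm p) (sp' : seminorm p') (symS : symmetric_seq S).
Hypotheses (eps_gt0 : 0 < eps) (fS : word_isometry p p' f S eps).

Let wsum u : G := \sum_(x <- u) x.

(* Gluing [s] to [f s], for [s] in [S], at cost [eps]. *)
Let Rel (x : G * G) (r : R) : Prop := exists2 u, all (mem S) u &
  p (x.1 - wsum u) + p' (x.2 + f (wsum u)) + eps * (size u)%:R <= r.

(** A word carries its sum from one factor to the other at cost [eps] per letter. By [fS] the norm
    changes by no more than this cost, so no detour shortens an element of either factor. *)
Lemma word_isometry_amalgam : exists nu : G * G -> R, [/\ seminorm nu,
  forall a, nu (a, 0) = p a, forall b, nu (0, b) = p' b &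
  forall s, s \in S -> nu (s, - f s) <= eps].
Proof.
have e0 := ltW eps_gt0.
have Rel_ge0 x r : Rel x r -> 0 <= r.
  move=> [u _]; apply: le_trans.
  by rewrite !addr_ge0 ?mulr_ge0 ?(seminorm_ge0 sp) ?(seminorm_ge0 sp').
have Rel_self x : Rel x (p x.1 + p' x.2).
  exists [::] => //; by rewrite /wsum big_nil subr0 raddf0 !addr0 mulr0 addr0.
have Rel_total x : exists r, Rel x r by exists (p x.1 + p' x.2).
exists (cost_inf Rel); split.
- apply: cost_inf_seminorm => //.
  + by have := Rel_self 0; rewrite (seminorm0 sp) (seminorm0 sp') addr0.
  + move=> x r [u uS le_r]; exists (map -%R u).
      by rewrite all_map; apply/allP => y yu /=; apply: symS; exact: (allP uS).
    rewrite size_map (_ : wsum (map -%R u) = - wsum u); last first.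
      by rewrite /wsum big_map sumrN.
    rewrite (raddfN f) -[(- x).1]/(- x.1) -[(- x).2]/(- x.2) -!opprD.
    by rewrite (seminormN sp) (seminormN sp').
  + move=> x y r s [u uS le_r] [v vS le_s]; exists (u ++ v).
      by rewrite all_cat uS vS.
    have -> : wsum (u ++ v) = wsum u + wsum v by rewrite /wsum big_cat.
    rewrite size_cat natrD mulrDr (raddfD f) opprD.
    rewrite -[(x + y).1]/(x.1 + y.1) -[(x + y).2]/(x.2 + y.2).
    rewrite (addrACA x.1) (addrACA x.2).
    have := seminormD sp (x.1 - wsum u) (y.1 - wsum v).
    have := seminormD sp' (x.2 + f (wsum u)) (y.2 + f (wsum v)).
    by move: le_r le_s; lra.
- move=> a; apply/eqP; rewrite eq_le; apply/andP; split.
    by have := cost_inf_le Rel_ge0 (Rel_self (a, 0)); rewrite /= (seminorm0 sp') addr0.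
  apply: cost_inf_ge => // r [u uS /=]; rewrite add0r; apply: le_trans.
  have := fS uS; rewrite ler_norml -/(wsum u) => /andP [h _].
  by have := seminormD sp (a - wsum u) (wsum u); rewrite subrK; move: h; lra.
- move=> b; apply/eqP; rewrite eq_le; apply/andP; split.
    by have := cost_inf_le Rel_ge0 (Rel_self (0, b)); rewrite /= (seminorm0 sp) add0r.
  apply: cost_inf_ge => // r [u uS /=]; rewrite sub0r (seminormN sp).
  apply: le_trans; have := fS uS; rewrite ler_norml -/(wsum u) => /andP [_ h].
  have := seminormB sp' (b + f (wsum u)) (f (wsum u)); rewrite addrK.
  by move: h; lra.
- move=> s sS; apply: cost_inf_le => //; exists [:: s]; first by rewrite /= sS.
  rewrite /wsum big_seq1 /= subrr addNr (seminorm0 sp) (seminorm0 sp').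
  by rewrite !add0r mulr1.
Qed.

End Amalgam.

End Words.

(** * Back-and-forth between two generic norms *)

Section BackAndForth.
Context {R : realType} {G : zmodType} (c : coordinates G) (e : nat -> G).
Hypothesis e_surj : forall x, exists n, e n = x.
Hypothesis unbounded_G : unbounded_group G.
Implicit Types d : invariant_metrics R G.

(** Glue [d] and [d'] along [f] and realise the amalgam inside [d]: the second factor is mapped by
    [f']. Prescribing its norm on the word sums of [S'] makes [f'] almost isometric, and prescribing
    the small seminorm of [(s, - f s)] makes [f'] almost inverse to [f]. *)
Lemma word_isometry_step d d' (f : {additive G -> G}) (S S' : seq G)
    (eps eps' : R) :
  generic e d -> generic e d' -> symmetric_seq S -> 0 < eps -> 0 < eps' ->
  word_isometry (mnorm d) (mnorm d') f S eps ->
  exists f' : {additive G -> G},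
    word_isometry (mnorm d') (mnorm d) f' S' eps' /\
    forall s, s \in S -> mnorm d (f' (f s) - s) <= eps + eps.
Proof.
move=> gd gd' symS eps0 eps'0 fS.
have sd := mnorm_seminorm d; have sd' := mnorm_seminorm d'.
have sld : slow (mnorm d') by move=> x; exact: slow_growth.
have [nu [snu nu1 nu2 nuS]] := word_isometry_amalgam sd sd' symS eps0 fS.
have [T hT] := word_isometry_of_close S' sd' sd sld eps'0.
pose F := [seq (0, k) | k <- word_sums S' T] ++ [seq (s, - f s) | s <- S].
have m0 : 0 < Num.min (Num.min eps' 1) eps by rewrite !lt_min eps'0 ltr01.
have [f' hf'] := generic_amalgam c e_surj F gd snu nu1 m0.
exists f'; split=> [|s sS].
  apply: hT => x xT; have := hf' (0, x); rewrite mem_cat map_f //= => /(_ isT).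
  by rewrite nu2 add0r lt_min => /andP [/ltW].
have := hf' (s, - f s); rewrite mem_cat orbC (map_f (fun s => (s, - f s)) sS).
move=> /(_ isT) /=; rewrite lt_min => /andP [_].
rewrite raddfN ltr_norml => /andP [_]; rewrite (seminormC sd); have := nuS s sS.
lra.
Qed.

Definition alternate d d' (i : nat) := if odd i then d' else d.

Lemma back_and_forth d d' : generic e d -> generic e d' ->
  let dd := alternate d d' in
  exists (S : nat -> seq G) (f : nat -> {additive G -> G}), [/\
    forall i x, x \in S i -> x \in S i.+1,
    forall x, exists i, x \in S i,
    forall i x, x \in S i -> f i x \in S i.+1,
    forall i x y, x \in S i -> y \in S i ->
      `|mnorm (dd i.+1) (f i (x - y)) - mnorm (dd i) (x - y)| <= 2 * 2^-1 ^+ i &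
    forall i x, x \in S i ->
      mnorm (dd i) (f i.+1 (f i x) - x) <= 2 * 2^-1 ^+ i].
Proof.
move=> gd gd' dd; have gdd i : generic e (dd i) by rewrite /dd /alternate; case: odd.
have ddSS i : dd i.+2 = dd i by rewrite /dd /alternate /= negbK.
pose eps i : R := 2^-1 ^+ i; have eps0 i : 0 < eps i by rewrite exprn_gt0 ?invr_gt0.
pose grow i (S : seq G) (f : {additive G -> G}) : seq G :=
  let S' := e i :: S ++ map f S in S' ++ map -%R S'.
have sym_grow i S f : symmetric_seq (grow i S f).
  move=> x; rewrite /grow mem_cat => /orP [xS|/mapP [y yS ->]]; rewrite mem_cat.
    by rewrite map_f ?orbT.
  by rewrite opprK yS.
(* The invariant is a premise inside the statement so that [choice] yields a total function; states
   violating it get a dummy value. *)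
have step (a : nat * (seq G * {additive G -> G})) : exists f' : {additive G -> G},
    let i := a.1 in let S := a.2.1 in let f := a.2.2 in symmetric_seq S ->
    word_isometry (mnorm (dd i)) (mnorm (dd i.+1)) f S (eps i) ->
    word_isometry (mnorm (dd i.+1)) (mnorm (dd i.+2)) f' (grow i S f) (eps i.+1) /\
    forall s, s \in S -> mnorm (dd i) (f' (f s) - s) <= eps i + eps i.
  case: a => i [S f] /=.
  have [[symS fS]|nh] := pselect (symmetric_seq S /\
      word_isometry (mnorm (dd i)) (mnorm (dd i.+1)) f S (eps i)); last first.
    by exists f => symS fS; case: nh.
  have [f' hf'] := word_isometry_step (grow i S f) (gdd i) (gdd i.+1) symS
    (eps0 i) (eps0 i.+1) fS.
  by exists f' => _ _; rewrite ddSS.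
have [nxt hnxt] := choice step.
(* The initial list is empty, so the only word is the empty one and any morphism, here [cinj c 0],
   can start the construction. *)
pose st := fix st i : seq G * {additive G -> G} :=
  if i is j.+1 then (grow j (st j).1 (st j).2, nxt (j, st j)) else ([::], cinj c 0).
have st_ok i : symmetric_seq (st i).1 /\
    word_isometry (mnorm (dd i)) (mnorm (dd i.+1)) (st i).2 (st i).1 (eps i).
  elim: i => [|i [symS fS]] /=.
    split=> // -[|//] _; rewrite big_nil raddf0 !(seminorm0 (mnorm_seminorm _)).
    by rewrite subrr normr0 mulr0.
  split; first exact: sym_grow.
  by have [] := hnxt (i, st i) symS fS.
exists (fun i => (st i).1), (fun i => (st i).2); split.
- by move=> i x xS /=; rewrite /grow mem_cat inE mem_cat xS orbT.
- move=> x; have [i ix] := e_surj x; exists i.+1.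
  by rewrite /= /grow mem_cat inE ix eqxx.
- by move=> i x xS /=; rewrite /grow mem_cat inE mem_cat map_f ?orbT.
(* A difference is a word of two letters, whence the factor 2. *)
- move=> i x y xS yS; have [symS /(_ [:: x; - y])] := st_ok i.
  rewrite /= xS symS // => /(_ isT); rewrite big_cons big_seq1.
  by rewrite mulrC.
- move=> i x xS; have [symS fS] := st_ok i.
  have [_ /(_ x xS)] := hnxt (i, st i) symS fS.
  by rewrite mulr_natl mulr2n.
Qed.

End BackAndForth.

(** * Complete metric spaces and the Urysohn space *)

Section CompleteMetric.
Context {R : realType}.

Lemma half_pow_small (C eps : R) : 0 < eps -> exists n : nat, C * 2^-1 ^+ n < eps.
Proof.
move=> eps0; have h : (fun n : nat => C * 2^-1 ^+ n : R) @ \oo --> C * 0.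
  apply: cvgMl_tmp; apply: cvg_expr; rewrite ger0_norm ?invr_ge0 //; lra.
rewrite mulr0 in h; have /cvgr0Pnorm_lt /(_ eps eps0) [n _ hn] := h.
exists n; apply: le_lt_trans (hn n (leqnn n)); exact: ler_norm.
Qed.

Lemma half_powS n : 2^-1 ^+ n = 2^-1 ^+ n.+1 + 2^-1 ^+ n.+1 :> R.
Proof. by rewrite exprS; lra. Qed.

Lemma half_pow_gt0 n : 0 < 2^-1 ^+ n :> R.
Proof. by rewrite exprn_gt0 // invr_gt0. Qed.

Lemma geometric_limit (X : metricType R) (x : nat -> X) (C : R) :
  complete_space X -> (forall n, mdist (x n) (x n.+1) <= C * 2^-1 ^+ n) ->
  exists l, forall n, mdist (x n) l <= 2 * C * 2^-1 ^+ n.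
Proof.
move=> cX hx.
(* The remaining tail of the geometric series is carried along to make the induction on [k] work. *)
have tail n k : mdist (x n) (x (n + k)%N) + 2 * C * 2^-1 ^+ (n + k) <=
    2 * C * 2^-1 ^+ n.
  elim: k => [|k ih]; first by rewrite addn0 mdistxx add0r.
  have := hx (n + k)%N; have := metric_triangle (x n) (x (n + k)%N) (x (n + k).+1).
  by rewrite addnS; move: ih; rewrite (half_powS (n + k)) !mulrDr; lra.
have C0 : 0 <= C.
  by have := hx 0%N; rewrite expr0 mulr1; apply: le_trans; exact: mdist_ge0.
have le_tail n k : mdist (x n) (x (n + k)%N) <= 2 * C * 2^-1 ^+ n.
  apply: le_trans (tail n k); rewrite lerDl mulr_ge0 ?(ltW (half_pow_gt0 _)) //.
  by rewrite mulr_ge0.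
have cauchy_x : cauchy (x @ \oo).
  apply: cauchy_exP => e e0; have [N hN] := half_pow_small (2 * C) e0.
  exists (x N), N => // n /= Nn; rewrite ballEmdist /=.
  by rewrite (le_lt_trans _ hN) // -(subnKC Nn).
have [l hl] := cX _ _ cauchy_x; exists l => n.
apply/ler_addgt0Pr => e e0.
have /cvg_ballP/(_ e e0) [N _ hN] := hl.
have := hN (n + N)%N (leq_addl _ _); rewrite ballEmdist /= metric_sym => h.
have := metric_triangle (x n) (x (n + N)%N) l; have := le_tail n N; lra.
Qed.

Lemma mdist_small (X : metricType R) (x y : X) :
  (forall e, 0 < e -> mdist x y <= e) -> x = y.
Proof.
move=> h; apply: mdist_positivity; apply/eqP; rewrite eq_le mdist_ge0 andbT.
by apply/ler_addgt0Pr => e /h; rewrite add0r.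
Qed.

(** The densely defined isometry is given by its graph, the form in which back-and-forth produces
    it; [iso] makes the graph single-valued. *)
Lemma extend_isometry (X Y : metricType R) (rel : X -> Y -> Prop) :
  complete_space Y ->
  (forall x y x' y', rel x y -> rel x' y' -> mdist y y' = mdist x x') ->
  (forall x e, 0 < e -> exists x' y', rel x' y' /\ mdist x x' < e) ->
  exists2 f : X -> Y, is_isometry f & forall x y, rel x y -> f x = y.
Proof.
move=> cY iso dens.
have /choice [f hf] : forall x, exists l : Y, forall e, 0 < e ->
    exists x' y', [/\ rel x' y', mdist x x' < e & mdist l y' < e].
  move=> x; have /choice [b hb] : forall n : nat, exists b : X * Y,
      rel b.1 b.2 /\ mdist x b.1 < 2^-1 ^+ n.
    by move=> n; have [x' [y' h]] := dens x _ (half_pow_gt0 n); exists (x', y').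
  have [|l hl] := @geometric_limit _ (fun n => (b n).2) 2 cY.
    move=> n; have [r1 h1] := hb n; have [r2 h2] := hb n.+1.
    rewrite (iso _ _ _ _ r1 r2); have := metric_triangle (b n).1 x (b n.+1).1.
    rewrite (metric_sym _ x); move: h1 h2; rewrite (half_powS n).
    have := half_pow_gt0 n.+1; lra.
  exists l => e e0; have [n hn] := half_pow_small (2 * 2) e0.
  have [r1 h1] := hb n; exists (b n).1, (b n).2; split => //.
    by apply: lt_le_trans h1 _; have := half_pow_gt0 n; lra.
  by rewrite metric_sym (le_lt_trans (hl n)).
exists f => [x x'|x y xy].
  suff h e : 0 < e -> `|mdist (f x) (f x') - mdist x x'| <= e.
    apply/eqP; rewrite -subr_eq0 -normr_le0; apply/ler_addgt0Pr => e /h.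
    by rewrite add0r.
  move=> e0; have e40 : 0 < e / 4 by rewrite divr_gt0.
  have [a [b [ab xa yb]]] := hf x _ e40; have [a' [b' [ab' xa' yb']]] := hf x' _ e40.
  have := iso _ _ _ _ ab ab'.
  have := metric_triangle (f x) b (f x'); have := metric_triangle b b' (f x').
  have := metric_triangle b (f x) b'; have := metric_triangle (f x) (f x') b'.
  have := metric_triangle x a x'; have := metric_triangle a a' x'.
  have := metric_triangle a x a'; have := metric_triangle x x' a'.
  rewrite (metric_sym b (f x)) (metric_sym b' (f x')) (metric_sym a x).
  rewrite (metric_sym a' x') => *.
  by rewrite ler_norml; apply/andP; split; lra.
apply: mdist_small => e e0; have e20 : 0 < e / 2 by rewrite divr_gt0.
have [a [b [ab xa yb]]] := hf x _ e20; have := iso _ _ _ _ ab xy.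
have := metric_triangle (f x) b y; rewrite (metric_sym a x); lra.
Qed.

(** Approximate preimages of [y] form a Cauchy sequence because [f] is isometric, and their limit is
    a preimage. *)
Lemma isometry_bijective (X Y : metricType R) (f : X -> Y) :
  complete_space X -> is_isometry f ->
  (forall y e, 0 < e -> exists x, mdist (f x) y < e) -> bijective f.
Proof.
move=> cX isof dens.
have /choice [g hg] : forall y, exists x, f x = y.
  move=> y; have /choice [x hx] : forall n : nat, exists x, mdist (f x) y < 2^-1 ^+ n.
    by move=> n; exact: (dens y _ (half_pow_gt0 n)).
  have [|l hl] := @geometric_limit _ x 2 cX.
    move=> n; rewrite -isof; have := metric_triangle (f (x n)) y (f (x n.+1)).
    rewrite (metric_sym y); have := hx n; have := hx n.+1.
    rewrite (half_powS n); have := half_pow_gt0 n.+1; lra.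
  exists l; apply: mdist_small => e e0; have [n hn] := half_pow_small (2 * 2 + 1) e0.
  have := hl n; rewrite -isof; have := metric_triangle (f l) (f (x n)) y.
  rewrite (metric_sym (f l) (f _)); have := hx n; move: hn; rewrite mulrDl mul1r; lra.
exists g => // x; apply: mdist_positivity; by rewrite -isof hg mdistxx.
Qed.

Definition extension_property (X : metricType R) : Prop :=
  forall s : seq (X * R), katetov (@mdist R X) s ->
    exists x, forall t, t \in s -> mdist t.1 x = t.2.

(** An approximate solution [x] with error [eps n] is improved by solving again with the extra
    requirement of distance [eps n] to [x]. The new solution stays near [x], so the iteration
    converges. *)
Lemma extension_property_approx (X : metricType R) : complete_space X ->
  (forall (s : seq (X * R)) (e : R), katetov (@mdist R X) s ->
     (forall t, t \in s -> 0 < t.2) -> 0 < e ->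
     exists x, forall t, t \in s -> `|mdist t.1 x - t.2| < e) ->
  extension_property X.
Proof.
move=> cX approx s ks.
have [[t0 [t0s t00]]|pos] := pselect (exists t, t \in s /\ t.2 <= 0).
  exists t0.1 => t ts; have := ks _ _ ts t0s; have := ks _ _ t0s t0s.
  rewrite mdistxx => /andP [_ ?] /andP [? ?]; lra.
have {}pos t : t \in s -> 0 < t.2.
  by move=> ts; rewrite ltNge; apply/negP => t0; apply: pos; exists t.
have [m m0 hm] := finite_positive_bound pos.
(* Starting from [m] keeps [eps n] below all prescribed distances; this gives the Katetov inequality
   [eps n - t.2 <= mdist t.1 x] for the added pair. *)
pose eps n : R := m * 2^-1 ^+ n.
have eps0 n : 0 < eps n by rewrite mulr_gt0 ?half_pow_gt0.
have epsS n : eps n = eps n.+1 + eps n.+1 by rewrite /eps -mulrDr -half_powS.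
have eps_le n : eps n <= m.
  elim: n => [|n]; first by rewrite /eps mulr1.
  by rewrite (epsS n); have := eps0 n.+1; lra.
pose ok n x := forall t, t \in s -> `|mdist t.1 x - t.2| < eps n.
have step (a : nat * X) : exists y, ok a.1 a.2 -> ok a.1.+1 y /\
    mdist a.2 y <= 2 * m * 2^-1 ^+ a.1.
  case: a => n x /=; have [okx|nok] := pselect (ok n x); last by exists x.
  have [||//|y hy] := approx ((x, eps n) :: s) (eps n.+1).
  - have h t : t \in s -> [/\ t.2 - eps n <= mdist t.1 x,
        mdist t.1 x <= t.2 + eps n & eps n - t.2 <= mdist t.1 x].
      move=> ts; have := okx t ts; rewrite ltr_norml => /andP [? ?].
      by have := hm t ts; have := eps_le n; have := mdist_ge0 t.1 x; split; lra.
    move=> p q; rewrite !inE => /orP [/eqP ->|ps] /orP [/eqP ->|qs] /=.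
    + by rewrite mdistxx subrr lexx /= addr_ge0 // ltW.
    + by have [? ? ?] := h _ qs; rewrite metric_sym; apply/andP; split; lra.
    + by have [? ? ?] := h _ ps; apply/andP; split; lra.
    + exact: ks.
  - by move=> t; rewrite inE => /orP [/eqP -> //=|]; exact: pos.
  exists y => _; split; first by move=> t ts; apply: hy; rewrite inE ts orbT.
  have := hy (x, eps n) (mem_head _ _); rewrite /= ltr_norml => /andP [_].
  by have := epsS n; have := eps0 n.+1; rewrite -mulrA -/(eps n); lra.
have [nxt hnxt] := choice step.
have [x0 hx0] := approx s (eps 0%N) ks pos (eps0 0%N).
pose x := fix x n : X := if n is k.+1 then nxt (k, x k) else x0.
have x_ok n : ok n (x n).
  by elim: n => [|n ih] //=; have [] := hnxt (n, x n) ih.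
have [|l hl] := @geometric_limit _ x (2 * m) cX.
  by move=> n; have [] := hnxt (n, x n) (x_ok n).
exists l => t ts; apply/eqP; rewrite -subr_eq0 -normr_le0.
apply/ler_addgt0Pr => e e0; rewrite add0r.
have [n hn] := half_pow_small (m + 2 * (2 * m)) e0.
have := x_ok n t ts; rewrite ltr_norml /eps => /andP [? ?]; have := hl n.
have := metric_triangle t.1 (x n) l; have := metric_triangle t.1 l (x n).
rewrite (metric_sym l) => ? ? ?; rewrite mulrDl in hn.
by rewrite ler_norml; apply/andP; split; lra.
Qed.

(** * Extending finite partial isometries *)

Definition partial_isometry (X Y : metricType R) (L : seq (X * Y)) : Prop :=
  forall p q, p \in L -> q \in L -> mdist p.1 q.1 = mdist p.2 q.2.

Lemma partial_isometry_extend (X Y : metricType R) (L : seq (X * Y)) (x : X) :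
  extension_property Y -> partial_isometry L ->
  exists y, partial_isometry ((x, y) :: L).
Proof.
move=> extY pL; have [|y hy] := extY [seq (p.2, mdist p.1 x) | p <- L].
  move=> _ _ /mapP [p pL' ->] /mapP [q qL ->] /=; rewrite -(pL p q) //.
  have := metric_triangle p.1 q.1 x; have := metric_triangle p.1 x q.1.
  by rewrite (metric_sym x) => ? ?; apply/andP; split; lra.
exists y => p q; rewrite !inE => /orP [/eqP ->|pL'] /orP [/eqP ->|qL] /=.
- by rewrite !mdistxx.
- have := hy (q.2, mdist q.1 x); rewrite map_f //= => /(_ isT).
  by rewrite (metric_sym y) (metric_sym x).
- by have := hy (p.2, mdist p.1 x); rewrite map_f //= => /(_ isT).
- exact: pL.
Qed.

Definition swap_pairs (X Y : choiceType) (L : seq (X * Y)) : seq (Y * X) :=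
  [seq (p.2, p.1) | p <- L].

Lemma partial_isometry_swap (X Y : metricType R) (L : seq (X * Y)) :
  partial_isometry L -> partial_isometry (swap_pairs L).
Proof. by move=> pL _ _ /mapP [p pL' ->] /mapP [q qL ->] /=; rewrite pL. Qed.

(* [u] and [v] enumerate the points to be added to the domain and to the range. *)
Lemma partial_isometry_saturate (X Y : metricType R) (L : seq (X * Y))
    (u : nat -> X) (v : nat -> option Y) :
  extension_property Y -> (forall n, v n -> extension_property X) ->
  partial_isometry L ->
  exists rel : X -> Y -> Prop, [/\
    forall x y x' y', rel x y -> rel x' y' -> mdist y y' = mdist x x',
    forall p, p \in L -> rel p.1 p.2, forall n, exists y, rel (u n) y &
    forall n y, v n = Some y -> exists x, rel x y].
Proof.
move=> extY extX pL.
have step (a : nat * seq (X * Y)) : exists L', partial_isometry a.2 -> [/\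
    partial_isometry L', {subset a.2 <= L'}, exists y, (u a.1, y) \in L' &
    forall y, v a.1 = Some y -> exists x, (x, y) \in L'].
  case: a => n K /=; have [pK|npK] := pselect (partial_isometry K); last by exists K.
  have [y py] := partial_isometry_extend (u n) extY pK.
  case vn : (v n) => [z|]; last first.
    exists ((u n, y) :: K) => _; split => //.
      by move=> p pK'; rewrite inE pK' orbT.
    by exists y; rewrite mem_head.
  have extX' : extension_property X by apply: (extX n); rewrite vn.
  have [x px] := partial_isometry_extend z extX' (partial_isometry_swap py).
  exists ((x, z) :: (u n, y) :: K) => _; split.
  - by have := partial_isometry_swap px; rewrite /swap_pairs /= -map_comp map_id_in // => -[].
  - by move=> p pK'; rewrite !inE pK' !orbT.
  - by exists y; rewrite !inE eqxx orbT.
  - by move=> _ [<-]; exists x; rewrite mem_head.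
have [nxt hnxt] := choice step.
pose K := fix K n : seq (X * Y) := if n is k.+1 then nxt (k, K k) else L.
have pK n : partial_isometry (K n).
  by elim: n => [|n ih] //=; have [] := hnxt (n, K n) ih.
have subK m n : (m <= n)%N -> {subset K m <= K n}.
  elim: n => [|n ih]; first by rewrite leqn0 => /eqP ->.
  rewrite leq_eqVlt => /orP [/eqP -> //|/ih h p /h].
  by have [_ + _ _] := hnxt (n, K n) (pK n); apply.
exists (fun x y => exists n, (x, y) \in K n); split.
- move=> x y x' y' [m h] [n h']; have := pK (maxn m n) (x, y) (x', y').
  by move=> /= ->; [|apply: subK h; exact: leq_maxl|apply: subK h'; exact: leq_maxr].
- by move=> p pL'; exists 0%N; rewrite -surjective_pairing.
- by move=> n; have [_ _ [y hy] _] := hnxt (n, K n) (pK n); exists y, n.+1.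
- by move=> n y vn; have [_ _ _ /(_ y vn) [x hx]] := hnxt (n, K n) (pK n); exists x, n.+1.
Qed.

Lemma dense_approx (X : metricType R) (A : set X) (x : X) (e : R) :
  dense A -> 0 < e -> exists2 a, A a & mdist x a < e.
Proof.
move=> dA e0; have [||a [/interior_subset xa Aa]] := dA (interior (ball x e)).
- by exists x; apply: nbhs_singleton; apply: nbhs_interior; exact: nbhsx_ballx.
- exact: open_interior.
- by exists a => //; move: xa; rewrite ballEmdist.
Qed.

Lemma separable_sequence (X : metricType R) : separable X -> [set: X] !=set0 ->
  exists u : nat -> X, forall x e, 0 < e -> exists n, mdist x (u n) < e.
Proof.
move=> [A [/countable_injP [f finj] dA]] [x0 _].
have /choice [u hu] : forall n, exists x : X, forall a, A a -> f a = n -> x = a.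
  move=> n; have [[a [Aa fa]]|na] := pselect (exists a, A a /\ f a = n).
    by exists a => b Ab fb; apply: finj; rewrite ?inE // fa fb.
  by exists x0 => a Aa fa; case: na; exists a.
exists u => x e e0; have [a Aa xa] := dense_approx x dA e0.
by exists (f a); rewrite (hu _ a).
Qed.

(** Going forth along a dense sequence embeds a separable space. Going back and forth along a dense
    sequence of [U] extends a finite partial isometry to one with dense domain and range, hence to a
    bijection. *)
Lemma extension_property_Urysohn (U : metricType R) : complete_space U ->
  separable U -> [set: U] !=set0 -> extension_property U -> is_Urysohn_space U.
Proof.
move=> cU sU U0 extU; split=> // [X sX|A f finA isoA].
  have [X0|/set0P/negP/negPn/eqP X0] := pselect ([set: X] !=set0); last first.
    have emptyX (x : X) : False by have : [set: X] x by []; rewrite X0.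
    have [u _] := U0.
    by exists (fun x => False_rect _ (emptyX x)) => x; case: (emptyX x).
  have [u hu] := separable_sequence sX X0.
  have [//|//|rel [iso _ dom _]] := @partial_isometry_saturate X U [::] u (fun=> None) extU.
  have [x e e0|f fiso _] := extend_isometry cU iso; last by exists f.
  by have [n xn] := hu x e e0; have [y ry] := dom n; exists (u n), y.
have [u hu] := separable_sequence sU U0.
have /finite_seqP [a aA] := finA.
have [//||rel [iso relL dom ran]] :=
    @partial_isometry_saturate U U [seq (x, f x) | x <- a] u (Some \o u) extU.
  move=> _ _ /mapP [x xa ->] /mapP [y ya ->] /=; rewrite isoA //.
    by rewrite aA.
  by rewrite aA.
have [x e e0|g giso grel] := extend_isometry cU iso.
  by have [n xn] := hu x e e0; have [y ry] := dom n; exists (u n), y.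
exists g; split => //.
  apply: (isometry_bijective cU giso) => y e e0; have [n yn] := hu y e e0.
  have [x rx] := ran n (u n) erefl; exists x.
  by rewrite (grel _ _ rx) metric_sym.
move=> x Ax; apply: grel; apply: (relL (x, f x)).
by apply: map_f; move: Ax; rewrite aA.
Qed.

End CompleteMetric.

(** * Completions of generic metrics *)

Section Completions.
Context {R : realType} {G : zmodType}.
Implicit Types d : invariant_metrics R G.

Lemma mdist_to d x y :
  mdist (to_completion d x) (to_completion d y) = mnorm d (x - y).
Proof. by rewrite mdist_to_completion idistE. Qed.

Lemma completion_separable d : countable [set: G] -> separable (completion d).
Proof.
move=> cG; exists (range (to_completion d)); split.
  exact: sub_countable (card_image_le _ _) cG.
exact: dense_to_completion.
Qed.

Lemma finite_argmin (T : eqType) (s : seq T) (f : T -> R) t0 : t0 \in s ->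
  exists2 t, t \in s & forall t', t' \in s -> f t <= f t'.
Proof.
elim: s t0 => [|a s ih] // t0 _; case: s ih => [|b s] ih.
  by exists a => [|t']; rewrite inE // => /eqP ->.
have [t ts ht] := ih b (mem_head _ _); have [ta|at_] := leP (f t) (f a).
  exists t; first by rewrite inE ts orbT.
  by move=> t'; rewrite inE => /orP [/eqP ->|/ht].
exists a; first exact: mem_head.
by move=> t'; rewrite inE => /orP [/eqP ->|/ht] //; apply: le_trans; exact: ltW.
Qed.

Variables (c : coordinates G) (e : nat -> G).
Hypothesis e_surj : forall x, exists n, e n = x.
Hypothesis unbounded_G : unbounded_group G.

(** The prescribed points need not lie in [G]. The Katetov function is therefore extended to the
    whole completion by [E y], the least value of [mdist y t.1 + t.2], and read off at nearby points
    of [G], where [point_extension] applies. *)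
Lemma completion_extension_property d :
  generic e d -> extension_property (completion d).
Proof.
move=> gd; apply: extension_property_approx; first exact: completion_complete.
move=> s eps ks s_gt0 eps0; case: s ks s_gt0 => [|t0 s0]; first by exists 0.
set s := t0 :: s0 => ks s_gt0.
pose cost (y : completion d) (t : completion d * R) := mdist y t.1 + t.2.
have /choice [E hE] : forall y, exists r, (exists2 t, t \in s & r = cost y t) /\
    forall t, t \in s -> r <= cost y t.
  move=> y; have [t ts ht] := finite_argmin (cost y) (mem_head t0 s0 : t0 \in s).
  by exists (cost y t); split => //; exists t.
have E_ge0 y : 0 <= E y.
  have [[t ts ->] _] := hE y; rewrite addr_ge0 ?mdist_ge0 // ltW //; exact: s_gt0.
have E_lip y z : E y - E z <= mdist y z.
  have [_ hy] := hE y; have [[t ts ->] _] := hE z; have := hy t ts.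
  by rewrite /cost; have := metric_triangle y z t.1; lra.
have E_tri y z : mdist y z <= E y + E z.
  have [[t ts ->] _] := hE y; have [[t' ts' ->] _] := hE z.
  have /andP [_] := ks t t' ts ts'; rewrite /cost (metric_sym z).
  have := metric_triangle y t.1 z; have := metric_triangle t.1 t'.1 z; lra.
have E_near t y : t \in s -> `|E y - t.2| <= mdist t.1 y.
  move=> ts; have [[t' ts' Ey] hy] := hE y; have := hy t ts.
  have /andP [+ _] := ks t t' ts ts'; rewrite Ey /cost (metric_sym y t.1).
  have := metric_triangle t.1 y t'.1 => *.
  by rewrite ler_norml; apply/andP; split; lra.
have eta0 : 0 < eps / 4 by rewrite divr_gt0.
have /choice [g hg] : forall a : completion d, exists g : G,
    mdist a (to_completion d g) < eps / 4.
  by move=> a; exact: to_completion_approx.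
(* Adding [eps / 4] makes the values positive and preserves the Katetov inequalities. *)
pose s' := [seq (g t.1, E (to_completion d (g t.1)) + eps / 4) | t <- s].
have [||//|x [_ [_ _ hx]]] := @point_extension _ _ c e e_surj unbounded_G d gd s' (eps / 4).
- move=> _ _ /mapP [p ps ->] /mapP [q qs ->] /=; rewrite -mdist_to.
  have := E_lip (to_completion d (g p.1)) (to_completion d (g q.1)).
  have := E_tri (to_completion d (g p.1)) (to_completion d (g q.1)).
  by move=> ? ?; apply/andP; split; lra.
- by move=> _ /mapP [p ps ->] /=; have := E_ge0 (to_completion d (g p.1)); lra.
exists (to_completion d x) => t ts.
have := hx _ (map_f _ ts); rewrite /= -mdist_to.
have := E_near t (to_completion d (g t.1)) ts; have := hg t.1.
have := metric_triangle t.1 (to_completion d (g t.1)) (to_completion d x).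
have := metric_triangle (to_completion d (g t.1)) t.1 (to_completion d x).
rewrite (metric_sym _ t.1) !ltr_norml ler_norml => ? ? ? /andP [? ?] /andP [? ?].
by apply/andP; split; lra.
Qed.

Lemma completion_isometric_to_Urysohn d : countable [set: G] ->
  generic e d -> isometric_to_Urysohn (completion d).
Proof.
move=> cG gd; exists (completion d); last by exists id => //; exists id.
apply: extension_property_Urysohn; first exact: completion_complete.
- exact: completion_separable.
- by exists 0.
- exact: completion_extension_property.
Qed.

Lemma extend_morphism d d' (phi : G -> completion d') :
  zmod_morphism phi ->
  (forall x, mdist (phi x) 0 = mnorm d x) ->
  (forall y eps, 0 < eps -> exists x, mdist (phi x) y < eps) ->
  exists f : {additive completion d -> completion d'}, bijective f /\ is_isometry f.
Proof.
move=> phiB phi_iso phi_dense.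
have distB (a b : completion d') : mdist a b = mdist (a - b) 0.
  apply/eqP; rewrite eq_le; apply/andP; split.
    have := completion_distB (a - b) (- b) 0 (- b).
    by rewrite mdistxx addr0 opprK subrK add0r.
  by have := completion_distB a b b b; rewrite mdistxx addr0 subrr.
pose rel X Y := exists x, X = to_completion d x /\ Y = phi x.
have [|X eps eps0|f fiso frel] := @extend_isometry _ _ _ rel (@completion_complete _ _ d').
- move=> X Y X' Y' [x [-> ->]] [y [-> ->]].
  by rewrite distB -phiB phi_iso mdist_to.
- have [g hg] := to_completion_approx X eps0.
  by exists (to_completion d g), (phi g); split => //; exists g.
have fto x : f (to_completion d x) = phi x by apply: frel; exists x.
have fB : zmod_morphism f.
  move=> a b; apply: mdist_small => eps eps0.
  have e40 : 0 < eps / 4 by rewrite divr_gt0.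
  have [g hg] := to_completion_approx a e40.
  have [h hh] := to_completion_approx b e40.
  have := metric_triangle (f (a - b)) (f (to_completion d (g - h))) (f a - f b).
  rewrite fiso raddfB; have := completion_distB a b (to_completion d g) (to_completion d h).
  rewrite -raddfB fto phiB -!fto.
  have := completion_distB (f (to_completion d g)) (f (to_completion d h)) (f a) (f b).
  rewrite !fiso (metric_sym (to_completion d g)) (metric_sym (to_completion d h)).
  by rewrite raddfB; lra.
pose fM := GRing.isZmodMorphism.Build (completion d) (completion d') f fB.
pose fA : {additive completion d -> completion d'} := HB.pack f fM.
exists fA; split; last exact: fiso.
apply: isometry_bijective fiso _; first exact: completion_complete.
move=> y eps eps0; have [x hx] := phi_dense y eps eps0.
by exists (to_completion d x); rewrite fto.
Qed.

(** The even maps of the back-and-forth go from [d] to [d'] and converge pointwise to an isometric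
    morphism into the completion. The odd maps supply approximate preimages, so its range is
    dense. *)
Lemma generic_completions_isometric d d' : generic e d -> generic e d' ->
  exists f : {additive completion d -> completion d'}, bijective f /\ is_isometry f.
Proof.
move=> gd gd'.
have [S [f [Smono Sall Sf fiso finv]]] := back_and_forth c e_surj unbounded_G gd gd'.
set dd := alternate d d' in fiso finv.
have ddSS i : dd i.+2 = dd i by rewrite /dd /alternate /= negbK.
have dd0 m : dd m.*2 = d by rewrite /dd /alternate odd_double.
have dd1 m : dd m.*2.+1 = d' by rewrite /dd /alternate /= odd_double.
have Sle i j : (i <= j)%N -> {subset S i <= S j}.
  elim: j => [|j ih]; first by rewrite leqn0 => /eqP ->.
  by rewrite leq_eqVlt => /orP [/eqP -> //|/ih h x /h /Smono].
(* Both [f j.+2 x] and [f j x] are close to [f j.+2 (f j.+1 (f j x))]: the first because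
   [f j.+1 (f j x)] is close to [x] and [f j.+2] almost isometric, the second because [f j.+2]
   almost inverts [f j.+1]. *)
have step j x : x \in S j ->
    mnorm (dd j.+1) (f j.+2 x - f j x) <= 4 * 2^-1 ^+ j.
  move=> xj; have sd := mnorm_seminorm (dd j.+1).
  have yj := Sf _ _ xj; have zj := Sf _ _ yj; have xj2 := Smono _ _ (Smono _ _ xj).
  have := fiso _ _ _ zj xj2; rewrite ddSS ddSS ler_norml => /andP [_].
  have := finv _ _ yj; have := finv _ _ xj.
  have := seminormB sd (f j.+2 (f j.+1 (f j x)) - f j x) (f j.+2 (f j.+1 (f j x) - x)).
  rewrite raddfB opprB addrC addrA subrK.
  have := @half_powS R j; have := @half_powS R j.+1; have := @half_pow_gt0 R j.+2.
  lra.
have half_double m : 2^-1 ^+ m.*2 <= 2^-1 ^+ m :> R.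
  by rewrite ler_wiXn2l ?invr_ge0 ?invf_le1 ?ler1n // -addnn leq_addr.
have /choice [phi hphi] : forall x, exists l : completion d', forall m,
    x \in S m.*2 -> mdist (to_completion d' (f m.*2 x)) l <= 8 * 2^-1 ^+ m.
  move=> x; have exm : exists m, x \in S m.*2.
    by have [i xi] := Sall x; exists i; apply: Sle xi; rewrite -addnn leq_addr.
  case: (ex_minnP exm) => m0 xm0 m0min.
  have [|l hl] := @geometric_limit _ _
      (fun k => to_completion d' (f (m0 + k).*2 x)) (4 * 2^-1 ^+ m0)
      (@completion_complete _ _ d').
    move=> k; rewrite mdist_to (seminormC (mnorm_seminorm d')) addnS doubleS.
    have := step (m0 + k).*2 x; rewrite dd1 => h; apply: (le_trans (h _)).
      by apply: Sle xm0; rewrite leq_double leq_addr.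
    by rewrite -mulrA -exprD ler_pM2l.
  exists l => m /m0min m0m; have := hl (m - m0)%N; rewrite subnKC //.
  by move=> h; apply: (le_trans h); rewrite !mulrA -natrM -mulrA -exprD subnKC.
have late (eps : R) x y : 0 < eps -> exists m, [/\ x \in S m.*2, y \in S m.*2,
    x - y \in S m.*2 & 2^-1 ^+ m < eps].
  move=> eps0; have [i xi] := Sall x; have [j yj] := Sall y.
  have [k xyk] := Sall (x - y); have [n hn] := half_pow_small 1 eps0.
  pose m := (i + j + k + n)%N; exists m; split.
  - by apply: Sle xi; rewrite /m; lia.
  - by apply: Sle yj; rewrite /m; lia.
  - by apply: Sle xyk; rewrite /m; lia.
  - rewrite mul1r in hn; apply: le_lt_trans hn.
    by rewrite ler_wiXn2l ?invr_ge0 ?invf_le1 ?ler1n // leq_addl.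
apply: (@extend_morphism _ _ phi).
- move=> x y; apply: mdist_small => eps eps0.
  have e240 : 0 < eps / 24 by rewrite divr_gt0.
  have [m [xm ym xym hm]] := late _ x y e240.
  have := metric_triangle (phi (x - y)) (to_completion d' (f m.*2 (x - y))) (phi x - phi y).
  have := hphi _ _ xym; rewrite [X in X <= _]metric_sym.
  have := completion_distB (to_completion d' (f m.*2 x)) (to_completion d' (f m.*2 y))
    (phi x) (phi y).
  have <- : to_completion d' (f m.*2 (x - y)) =
    to_completion d' (f m.*2 x) - to_completion d' (f m.*2 y) by rewrite !raddfB.
  by have := hphi _ _ xm; have := hphi _ _ ym; lra.
- move=> x; apply/eqP; rewrite -subr_eq0 -normr_le0.
  apply/ler_addgt0Pr => eps eps0; rewrite add0r.
  have e100 : 0 < eps / 10 by rewrite divr_gt0.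
  have [m [xm m0 _ hm]] := late _ x 0 e100.
  have := fiso _ _ _ xm m0; rewrite dd1 dd0 subr0 ler_norml => /andP [].
  have := half_double m; have := hphi _ _ xm.
  have := metric_triangle (phi x) (to_completion d' (f m.*2 x)) 0.
  have := metric_triangle (to_completion d' (f m.*2 x)) (phi x) 0.
  have -> : mdist (to_completion d' (f m.*2 x)) 0 = mnorm d' (f m.*2 x).
    by rewrite -(raddf0 (to_completion d')) mdist_to subr0.
  rewrite (metric_sym (phi x) (to_completion _ _)).
  by move=> *; rewrite ler_norml; apply/andP; split; lra.
- move=> y eps eps0; have e200 : 0 < eps / 20 by rewrite divr_gt0.
  have [t ht] := to_completion_approx y e200.
  have [m [tm _ _ hm]] := late _ t t e200.
  (* The odd map sends [t], a point of [G] close to [y], back to the source side; [f m.+1.*2] then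
     nearly returns it to [t]. *)
  exists (f m.*2.+1 t).
  have tm1 := Smono _ _ tm; have := Sf _ _ tm1; rewrite -doubleS => /hphi.
  have := finv _ _ tm1; rewrite dd1 -doubleS; rewrite -mdist_to.
  set x := f _ t; have := @half_powS R m; have := @half_pow_gt0 R m.+1.
  have := half_double m; have := @half_powS R m.*2.
  have := metric_triangle (phi x) (to_completion d' (f m.+1.*2 x)) y.
  have := metric_triangle (to_completion d' (f m.+1.*2 x)) (to_completion d' t) y.
  rewrite (metric_sym (phi x) (to_completion _ _)) (metric_sym (to_completion _ t) y).
  by rewrite doubleS; lra.
Qed.

End Completions.

(** * Extreme amenability *)

Section BoxAverage.
Context {R : realType} (L : nat).
Implicit Types (h : nat -> R) (F : seq nat -> R).

Let N : R := L.+1%:R.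
Let N_gt0 : 0 < N. Proof. by rewrite ltr0n. Qed.

Definition mean h : R := N^-1 * \sum_(i < L.+1) h i.

Lemma le_mean h h' : (forall i, (i <= L)%N -> h i <= h' i) -> mean h <= mean h'.
Proof.
move=> hh; rewrite ler_pM2l ?invr_gt0 //; apply: ler_sum => i _.
by apply: hh; rewrite -ltnS.
Qed.

Lemma meanD h h' : mean (fun i => h i + h' i) = mean h + mean h'.
Proof. by rewrite /mean big_split mulrDr. Qed.

Lemma meanM a h : mean (fun i => a * h i) = a * mean h.
Proof. by rewrite /mean -mulr_sumr mulrCA. Qed.

Lemma mean_cst a : mean (fun=> a) = a.
Proof.
by rewrite /mean sumr_const card_ord -mulr_natl mulrA mulVf ?mul1r // gt_eqF.
Qed.

Lemma mean_cyclic h : mean (fun i => h (i.+1 %% L.+1)%N) = mean h.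
Proof.
rewrite /mean; congr (_ * _); rewrite big_ord_recr big_ord_recl /= modnn addrC.
congr (_ + _); apply: eq_bigr => i _; rewrite modn_small ?lift0 //.
by rewrite ltnS ltn_ord.
Qed.

Lemma mean_witness h a : mean h <= a -> exists2 i, (i <= L)%N & h i <= a.
Proof.
move=> ha; apply: contrapT => nh; suff : a < mean h by rewrite ltNge ha.
have gt i : (i <= L)%N -> a < h i.
  by move=> iL; rewrite ltNge; apply/negP => hi; apply: nh; exists i.
rewrite -[a]mean_cst /mean ltr_pM2l ?invr_gt0 //.
apply: ltr_sum => [|i _]; last by apply: gt; rewrite -ltnS.
by apply/hasP; exists ord0; rewrite ?mem_index_enum.
Qed.

Lemma mean_variance h a : (forall i j, (i <= L)%N -> (j <= L)%N -> h i - h j <= a) ->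
  mean (fun i => h i ^+ 2) <= mean h ^+ 2 + a ^+ 2.
Proof.
move=> ha; set m := mean h.
have dev i : (i <= L)%N -> `|h i - m| <= a.
  move=> iL; have h1 : m <= h i + a.
    by rewrite -[h i + a]mean_cst; apply: le_mean => j jL; have := ha _ _ jL iL; lra.
  have h2 : h i - a <= m.
    by rewrite -[h i - a]mean_cst; apply: le_mean => j jL; have := ha _ _ iL jL; lra.
  by rewrite ler_norml; apply/andP; split; lra.
(* This is [(h i - m) ^+ 2 <= a ^+ 2] expanded, with a right-hand side affine in [h i]. *)
have : mean (fun i => h i ^+ 2) <= mean (fun i => (2 * m) * h i + (a ^+ 2 - m ^+ 2)).
  apply: le_mean => i /dev d; have : `|h i - m| ^+ 2 <= a ^+ 2.
    by rewrite ler_sqr ?nnegrE //; exact: le_trans d.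
  rewrite real_normK ?num_real // sqrrB -mulr_natr; lra.
by rewrite meanD meanM mean_cst -/m; lra.
Qed.

(** The uniform mean over a discrete cube, taken one coordinate at a time so that inductions peel
    off the head of the list. *)
Fixpoint average n F : R :=
  if n is n'.+1 then mean (fun i => average n' (fun s => F (i :: s))) else F [::].

Definition in_box n (s : seq nat) := (size s == n) && all (fun i => i <= L)%N s.

Lemma in_box_cons n i s : in_box n.+1 (i :: s) = (i <= L)%N && in_box n s.
Proof. by rewrite /in_box /= eqSS andbCA. Qed.

Lemma le_average n F F' : (forall s, in_box n s -> F s <= F' s) ->
  average n F <= average n F'.
Proof.
elim: n F F' => [|n ih] F F' FF' /=; first exact: FF'.
by apply: le_mean => i iL; apply: ih => s sn; apply: FF'; rewrite in_box_cons iL.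
Qed.

Lemma averageD n F F' : average n (fun s => F s + F' s) = average n F + average n F'.
Proof.
by elim: n F F' => [|n ih] F F' //=; rewrite -meanD; under eq_fun do rewrite ih.
Qed.

Lemma averageM n a F : average n (fun s => a * F s) = a * average n F.
Proof.
by elim: n F => [|n ih] F //=; rewrite -meanM; under eq_fun do rewrite ih.
Qed.

Lemma average_cst n a : average n (fun=> a) = a.
Proof. by elim: n => [|n ih] //=; rewrite ih mean_cst. Qed.

Lemma average_sum n (T : Type) (r : seq T) (F : T -> seq nat -> R) :
  average n (fun s => \sum_(t <- r) F t s) = \sum_(t <- r) average n (F t).
Proof.
elim: r => [|t r ih]; first by under eq_fun do rewrite big_nil; rewrite average_cst big_nil.
by under eq_fun do rewrite big_cons; rewrite averageD ih big_cons.
Qed.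

(** A permutation of the box standing for translation by the sum of all generators; the wraparound
    is what makes it preserve averages. *)
Definition cycle_box (s : seq nat) := [seq (i.+1 %% L.+1)%N | i <- s].

Lemma average_cycle n F : average n (F \o cycle_box) = average n F.
Proof.
elim: n F => [|n ih] F //=; rewrite -[RHS]mean_cyclic.
by under [in RHS]eq_fun do rewrite -ih.
Qed.

Lemma average_witness n F a : average n F <= a -> exists2 s, in_box n s & F s <= a.
Proof.
elim: n F => [|n ih] F /=; first by exists [::].
by move=> /mean_witness [i iL /ih [s sn Fs]]; exists (i :: s); rewrite ?in_box_cons ?iL.
Qed.

Definition box_lipschitz n F (a : R) : Prop := forall s1 s2 i j,
  in_box n (s1 ++ i :: s2) -> (j <= L)%N ->
  F (s1 ++ i :: s2) - F (s1 ++ j :: s2) <= a.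

(* The Efron-Stein inequality. *)
Lemma average_variance n F a : box_lipschitz n F a ->
  average n (fun s => F s ^+ 2) <= average n F ^+ 2 + a ^+ 2 *+ n.
Proof.
elim: n F => [|n ih] F Fa /=; first by rewrite mulr0n addr0.
(* The variance is the mean variance within the slices plus the variance of the slice averages
   [A i], which oscillate by at most [a]. *)
pose A i := average n (fun s => F (i :: s)).
have : mean (fun i => average n (fun s => F (i :: s) ^+ 2)) <=
    mean (fun i => A i ^+ 2 + a ^+ 2 *+ n).
  apply: le_mean => i iL; apply: ih => s1 s2 j k sn kL.
  by apply: (Fa (i :: s1)) => //; rewrite /= in_box_cons iL.
rewrite meanD mean_cst => /le_trans; apply; rewrite mulrSr [a ^+ 2 *+ n + _]addrC addrA.
rewrite lerD2r; apply: mean_variance => i j iL jL.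
rewrite /A lerBlDr -[a](average_cst n) -averageD; apply: le_average => s sn.
by rewrite -lerBlDr; apply: (Fa [::]) => //=; rewrite in_box_cons iL.
Qed.

(** [F t] and its shift have the same mean and small variance, so they are close in mean square.
    Averaging the sum over [r] gives one point good for all [t], at the price of the factor
    [size r]. *)
Lemma cycle_concentration n (T : eqType) (r : seq T) (F : T -> seq nat -> R) a :
  (forall t, t \in r -> box_lipschitz n (F t) a) ->
  exists2 s, in_box n s & forall t, t \in r ->
    (F t (cycle_box s) - F t s) ^+ 2 <= 4 * a ^+ 2 *+ n *+ size r.
Proof.
move=> Fa; pose D t s := (F t (cycle_box s) - F t s) ^+ 2.
have avD t : t \in r -> average n (D t) <= 4 * a ^+ 2 *+ n.
  move=> tr; set m := average n (F t).
  pose V s := (F t s - m) ^+ 2.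
  have avV : average n V <= a ^+ 2 *+ n.
    have -> : V = fun s => F t s ^+ 2 + ((- 2 * m) * F t s + m ^+ 2).
      by apply/funext => s; rewrite /V sqrrB -mulr_natr; ring.
    rewrite !averageD averageM average_cst -[average n (fun s => F t s)]/m.
    by have := average_variance (Fa t tr); rewrite -/m; lra.
  have : average n (D t) <= average n (fun s => 2 * (V \o cycle_box) s + 2 * V s).
    apply: le_average => s _; rewrite /D /V /= -subr_ge0.
    set x := F t (cycle_box s); set y := F t s.
    have -> : 2 * (x - m) ^+ 2 + 2 * (y - m) ^+ 2 - (x - y) ^+ 2 =
      (x + y - 2 * m) ^+ 2 by ring.
    exact: sqr_ge0.
  rewrite averageD !averageM average_cycle => /le_trans; apply.
  by rewrite -mulrnAr; lra.
have [|s sn hs] := @average_witness n (fun s => \sum_(t <- r) D t s)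
    (4 * a ^+ 2 *+ n *+ size r).
  have <- : \sum_(t <- r) (4 * a ^+ 2 *+ n) = 4 * a ^+ 2 *+ n *+ size r.
    by rewrite big_const_seq count_predT iter_addr_0.
  by rewrite average_sum big_seq [X in _ <= X]big_seq; apply: ler_sum.
exists s => // t tr; apply: le_trans hs; rewrite -/(D t s) (big_rem t tr) /= lerDl.
by apply: sumr_ge0 => u _; exact: sqr_ge0.
Qed.

End BoxAverage.

(** * Functions that hardly change along a translation *)

Section Oscillation.
Context {R : realType} {G : zmodType} (c : coordinates G) (e : nat -> G).
Hypothesis e_surj : forall x, exists n, e n = x.
Hypothesis unbounded_G : unbounded_group G.
Variable d : invariant_metrics R G.
Hypothesis dgen : generic e d.

Let sd := mnorm_seminorm d.

(* The seminorm realised here is the mean of the norms of [g + h_l] over the first [n]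
   coordinates [h_l] of [h]: it makes [x] the sum of [n] copies of [x] scaled
   down by [n]. *)
Lemma spread_out (x : G) (n L : nat) (eps : R) : (0 < n)%N -> 0 < eps ->
  exists y : nat -> G, mnorm d (x - \sum_(l < n) y l) < eps /\
    forall l k, (l < n)%N -> (k <= L)%N ->
      mnorm d (y l *+ k) < mnorm d (x *+ k) / n%:R + eps.
Proof.
move=> n0 eps0; have n0R : 0 < n%:R :> R by rewrite ltr0n.
pose nu (z : G * G) := n%:R^-1 * \sum_(l < n) mnorm d (z.1 + cproj c l z.2).
have snu : seminorm nu.
  split=> [|z|z w]; rewrite /nu.
  - rewrite big1 ?mulr0 // => l _.
    by rewrite -[(0 : G * G).1]/(0 : G) -[(0 : G * G).2]/(0 : G) raddf0 addr0 (seminorm0 sd).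
  - congr (_ * _); apply: eq_bigr => l _.
    by rewrite -[(- z).1]/(- z.1) -[(- z).2]/(- z.2) raddfN -opprD (seminormN sd).
  - rewrite -mulrDr ler_pM2l ?invr_gt0 // -big_split; apply: ler_sum => l _ /=.
    rewrite (raddfD (cproj c l)) addrACA.
    exact: (seminormD sd).
have nu_d a : nu (a, 0) = mnorm d a.
  rewrite /nu; under eq_bigr do rewrite raddf0 addr0.
  by rewrite sumr_const card_ord -(mulr_natl (mnorm d a)) mulrA mulVf ?mul1r // gt_eqF.
(* Each of the first [n] coordinates of [diag] is [x], so every term of the mean vanishes at
   [(x, - diag)]. *)
pose diag := \sum_(l < n) cinj c l x.
have proj_diag l : (l < n)%N -> cproj c l diag = x.
  move=> ln; rewrite /diag raddf_sum (bigD1 (Ordinal ln)) //= cinjK big1 ?addr0 //.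
  move=> i il; apply: cproj_cinj => li; move: il; apply/negP/negPn.
  by apply/eqP/val_inj; rewrite /= -li.
have nu_diag : nu (x, - diag) = 0.
  rewrite /nu big1 ?mulr0 // => l _.
  by rewrite raddfN proj_diag //= subrr (seminorm0 sd).
have nu_inj l k : (l < n)%N -> nu (0, cinj c l (x *+ k)) = mnorm d (x *+ k) / n%:R.
  move=> ln; rewrite /nu (bigD1 (Ordinal ln)) //= add0r cinjK mulrC big1 ?addr0 //.
  move=> i il; rewrite add0r cproj_cinj ?(seminorm0 sd) // => li.
  by move: il; apply/negP/negPn/eqP/val_inj; rewrite /= li.
pose F := (x, - diag) :: [seq (0, cinj c l (x *+ k)) | l <- iota 0 n, k <- iota 0 L.+1].
have [f hf] := generic_amalgam c e_surj F dgen snu nu_d eps0.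
exists (fun l => f (cinj c l x)); split.
  have := hf _ (mem_head _ _); rewrite nu_diag subr0 /= raddfN raddf_sum.
  by apply: le_lt_trans; exact: ler_norm.
move=> l k ln kL; have := hf (0, cinj c l (x *+ k)).
have kF : (0, cinj c l (x *+ k)) \in F.
  rewrite inE; apply/orP; right; apply/allpairsP; exists (l, k).
  by rewrite !mem_iota /= add0n.
move=> /(_ kF); rewrite nu_inj //= add0r !raddfMn ltr_norml => /andP [_].
by lra.
Qed.

(** Replace [f] by a nearby [x] with a short multiple [x *+ L.+1], and spread [x] over [n] elements
    [y l]. On the box of combinations of the [y l], changing one coordinate moves [psi t] by at most
    a constant over [n], so the variance is of order [1 / n], and [cycle_box] acts nearly as
    translation by [f]. *)
Lemma lipschitz_oscillation (T : eqType) (r : seq T) (psi : T -> G -> R)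
    (K : R) (f : G) (eps : R) : 0 <= K ->
  (forall t, t \in r -> forall g h, psi t g - psi t h <= K * mnorm d (g - h)) ->
  0 < eps ->
  exists g, forall t, t \in r -> `|psi t (f + g) - psi t g| <= eps.
Proof.
move=> K0 psiK eps0.
(* Translation by [f] and [cycle_box] will differ by at most [4 * eta]: one [eta] each for [f - x]
   and for [x] minus the sum of the [y l], and two for the wraparound. *)
pose eta := eps / (8 * (K + 1)).
have eta0 : 0 < eta by rewrite divr_gt0 // mulr_gt0 //; lra.
have K_eta : K * (4 * eta) <= eps / 2.
  have -> : eps / 2 = (K + 1) * (4 * eta).
    by rewrite /eta; field; rewrite gt_eqF //; lra.
  by rewrite ler_pM2r; [lra|rewrite mulr_gt0].
have eta20 : 0 < eta / 2 by rewrite divr_gt0.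
have [|t|x [L [L0 xL xf]]] := @point_extension _ _ c e e_surj unbounded_G d dgen
    [:: (f, eta / 2)] _ _ _ eta20.
- move=> s t; rewrite !inE => /eqP -> /eqP -> /=.
  by rewrite !subrr (seminorm0 sd) lexx /=; lra.
- by rewrite inE => /eqP ->.
case: L L0 xL => [//|L] _ xL.
have {xf} fx : mnorm d (f - x) < eta.
  by have := xf _ (mem_head _ _); rewrite /= ltr_norml => /andP [_]; lra.
have [B B0 hB] := finite_upper_bound (iota 0 L.+1) (fun k => mnorm d (x *+ k)).
pose J : R := (size r)%:R.
(* This is the bound of [cycle_concentration] for the Lipschitz constant [K * ((B + 1) / n)],
   required to be at most the square of [eps / 2]. *)
have [n n0 hn] : exists2 n : nat, (0 < n)%N &
    4 * (K * (B + 1)) ^+ 2 * J <= (eps / 2) ^+ 2 * n%:R.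
  pose A := 4 * (K * (B + 1)) ^+ 2 * J.
  have [m _ hm] := nbhs_infty_ger (A / (eps / 2) ^+ 2); exists m.+1 => //.
  have /= := hm m.+1 (leqnSn m).
  by rewrite ler_pdivrMr ?exprn_gt0 ?divr_gt0 // mulrC.
have n0R : 0 < n%:R :> R by rewrite ltr0n.
pose eps2 := Num.min (n%:R^-1) (eta / n%:R).
have eps20 : 0 < eps2 by rewrite lt_min invr_gt0 n0R divr_gt0.
have eps2_1 : eps2 <= n%:R^-1 by rewrite ge_min lexx.
have eps2_eta : eps2 <= eta / n%:R by rewrite ge_min lexx orbT.
have eta_n : eta / n%:R <= eta.
  by rewrite ler_pdivrMr // ler_peMr ?ler1n // ltW.
have [y [xy hy]] := spread_out x L.+1 n0 eps20.
have y_small l k : (l < n)%N -> (k <= L)%N -> mnorm d (y l *+ k) <= (B + 1) / n%:R.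
  move=> ln kL; apply: ltW; apply: (lt_le_trans (hy l k ln (leqW kL))).
  rewrite mulrDl mul1r lerD // ler_pM2r ?invr_gt0 //.
  by apply: hB; rewrite mem_iota.
have y_cycle l : (l < n)%N -> mnorm d (y l *+ L.+1) <= (2 * eta) / n%:R.
  move=> ln; apply: ltW; apply: (lt_le_trans (hy l L.+1 ln (leqnn _))).
  rewrite mulr2n (mulrDl 1 1) !mul1r mulrDl lerD // ler_pM2r ?invr_gt0 //.
  by lra.
pose pt (s : seq nat) := \sum_(l < n) y l *+ nth 0%N s l.
pose F t s := psi t (pt s).
have Flip t : t \in r -> box_lipschitz L n (F t) (K * ((B + 1) / n%:R)).
  move=> tr s1 s2 i j; rewrite /in_box size_cat /= all_cat /=.
  move=> /andP [/eqP sz /and3P [_ iL _]] jL.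
  apply: (le_trans (psiK t tr _ _)); rewrite ler_wpM2l //.
  have l1 : (size s1 < n)%N by rewrite -sz -addSnnS ltn_addr.
  have -> : pt (s1 ++ i :: s2) - pt (s1 ++ j :: s2) = y (size s1) *+ i - y (size s1) *+ j.
    rewrite /pt (bigD1 (Ordinal l1)) //= [X in _ - X](bigD1 (Ordinal l1)) //=.
    rewrite !nth_cat ltnn subnn /= opprD addrACA.
    rewrite -[RHS]addr0; congr (_ + _); apply/eqP; rewrite subr_eq0; apply/eqP.
    apply: eq_bigr => k ks; rewrite !nth_cat; case: ltnP => // sk.
    have : k != size s1 :> nat by apply: contraNneq ks => ks; exact/eqP/val_inj.
    case ks' : (k - size s1)%N => [|m] //; move/eqP in ks'.
    by move=> /negP []; rewrite eqn_leq sk andbT -subn_eq0 ks'.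
  wlog ij : i j iL jL {sz} / (i <= j)%N.
    move=> h; have [ij|/ltnW ji] := leqP i j; first exact: h.
    by rewrite (seminormC sd); exact: h.
  by rewrite (seminormC sd) -mulrnBr // y_small // (leq_trans (leq_subr _ _)).
have [s sn hs] := cycle_concentration Flip.
exists (pt s) => t tr.
have close : `|F t (cycle_box L s) - F t s| <= eps / 2.
  rewrite -ler_sqr ?nnegrE ?divr_ge0 ?(ltW eps0) // real_normK ?num_real //.
  apply: (le_trans (hs t tr)); rewrite -(ler_pM2r n0R); apply: le_trans hn.
  rewrite -(mulr_natr (4 * _)) -(mulr_natr (_ * n%:R)) -/J.
  by rewrite le_eqVlt; apply/orP; left; apply/eqP; field; rewrite gt_eqF.
have shift : mnorm d (f + pt s - pt (cycle_box L s)) <= 4 * eta.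
  (* A term of the last sum is zero unless its coordinate wraps around, in which case it is the
     short element [y l *+ L.+1]. *)
  have -> : f + pt s - pt (cycle_box L s) = (f - x) + (x - \sum_(l < n) y l) +
      \sum_(l < n) (y l *+ (nth 0%N s l).+1 - y l *+ nth 0%N (cycle_box L s) l).
    rewrite sumrB; under [\sum_(i < n) (_ *+ _.+1)]eq_bigr do rewrite mulrS.
    rewrite big_split /= -/(pt s) -/(pt (cycle_box L s)) addrA [in RHS]addrA.
    by rewrite !addrA !subrK.
  have h1 := seminormD sd ((f - x) + (x - \sum_(l < n) y l))
    (\sum_(l < n) (y l *+ (nth 0%N s l).+1 - y l *+ nth 0%N (cycle_box L s) l)).
  have h2 := seminormD sd (f - x) (x - \sum_(l < n) y l).
  have h3 : mnorm d (\sum_(l < n)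
      (y l *+ (nth 0%N s l).+1 - y l *+ nth 0%N (cycle_box L s) l)) <= 2 * eta.
    apply: (le_trans (seminorm_sum sd _ _ _)).
    have -> : 2 * eta = \sum_(l < n) (2 * eta) / n%:R.
      by rewrite sumr_const card_ord -(mulr_natr (2 * eta / _)) divfK // gt_eqF.
    apply: ler_sum => l _; move: sn => /andP [/eqP sz /allP sL].
    have ls : (l < size s)%N by rewrite sz.
    rewrite (nth_map 0%N) //; have := sL _ (mem_nth 0%N ls).
    rewrite leq_eqVlt => /orP [/eqP ->|lt_L].
      by rewrite modnn mulr0n subr0 y_cycle.
    rewrite modn_small ?ltnS // subrr (seminorm0 sd).
    by apply: divr_ge0; [lra|rewrite ler0n].
  by move: h1 h2 h3 fx xy eps2_eta eta_n; lra.
have h1 := psiK t tr (f + pt s) (pt (cycle_box L s)).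
have h2 := psiK t tr (pt (cycle_box L s)) (f + pt s).
rewrite (seminormC sd) in h2.
have h3 : K * mnorm d (f + pt s - pt (cycle_box L s)) <= K * (4 * eta) by rewrite ler_wpM2l.
move: close; rewrite /F !ler_norml => /andP [? ?]; apply/andP; split; lra.
Qed.

(* McShane's extension formula turns uniform continuity into a Lipschitz bound. *)
Lemma uniform_oscillation (T : eqType) (r : seq T) (phi : T -> G -> R) (f : G) (eps : R) :
  (forall t, t \in r -> forall g, 0 <= phi t g <= 1) ->
  (forall t, t \in r -> forall a, 0 < a -> exists2 b, 0 < b &
     forall u g, mnorm d u < b -> `|phi t (u + g) - phi t g| <= a) ->
  0 < eps ->
  exists g, forall t, t \in r -> `|phi t (f + g) - phi t g| <= eps.
Proof.
move=> phi01 phiU eps0; have e30 : 0 < eps / 3 by rewrite divr_gt0.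
have /choice [b hb] : forall t, exists b, t \in r -> 0 < b /\
    forall u g, mnorm d u < b -> `|phi t (u + g) - phi t g| <= eps / 3.
  move=> t; have [tr|ntr] := pselect (t \in r); last by exists 0.
  by have [b b0 h] := phiU t tr _ e30; exists b.
have [|b0 b00 hb0] := @finite_positive_bound R _ r b.
  by move=> t tr; have [] := hb t tr.
(* At distance at least [b0] the penalty is at least 1, the largest possible variation of [phi t];
   below [b0] uniform continuity applies. *)
pose K := b0^-1; have K0 : 0 < K by rewrite invr_gt0.
pose val t g := [set phi t h + K * mnorm d (h - g) | h in [set: G]].
pose psi t g := inf (val t g).
have val_lb t g : t \in r -> lbound (val t g) 0.
  move=> tr _ [h _ <-]; have /andP [? _] := phi01 t tr h.
  by rewrite addr_ge0 // mulr_ge0 ?(seminorm_ge0 sd) // ltW.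
have val0 t g : val t g !=set0 by exists (phi t g + K * mnorm d (g - g)), g.
have psi_le t g h : t \in r -> psi t g <= phi t h + K * mnorm d (h - g).
  by move=> tr; apply: ge_inf; [exists 0; exact: val_lb|exists h].
have psi_phi t g : t \in r -> `|psi t g - phi t g| <= eps / 3.
  move=> tr; have := psi_le t g g tr; rewrite subrr (seminorm0 sd) mulr0 addr0 => h1.
  have h2 : phi t g - eps / 3 <= psi t g.
    apply: lb_le_inf => // _ [h _ <-].
    have [lt_b|le_b] := ltP (mnorm d (h - g)) b0.
      have [_ /(_ (h - g) g (lt_le_trans lt_b (hb0 t tr)))] := hb t tr.
      rewrite subrK ler_norml => /andP [? _].
      have : 0 <= K * mnorm d (h - g) by rewrite mulr_ge0 ?(seminorm_ge0 sd) // ltW.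
      lra.
    have : 1 <= K * mnorm d (h - g) by rewrite mulrC ler_pdivlMr ?mul1r.
    have /andP [? _] := phi01 t tr h; have /andP [_ ?] := phi01 t tr g; lra.
  by rewrite ler_norml; apply/andP; split; lra.
have psi_lip t : t \in r -> forall g h, psi t g - psi t h <= K * mnorm d (g - h).
  move=> tr g h; rewrite lerBlDr -lerBlDl; apply: lb_le_inf => // _ [k _ <-].
  rewrite lerBlDl; apply: (le_trans (psi_le t g k tr)).
  rewrite [X in _ <= X]addrCA lerD2l -mulrDr ler_pM2l // (seminormC sd g) [X in _ <= X]addrC.
  exact: (seminorm_trans sd).
have [g hg] := lipschitz_oscillation f (ltW K0) psi_lip e30.
exists g => t tr; have := hg t tr; have := psi_phi t (f + g) tr; have := psi_phi t g tr.
by rewrite !ler_norml => /andP [? ?] /andP [? ?] /andP [? ?]; apply/andP; split; lra.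
Qed.

End Oscillation.

Lemma closed_equalizer (T X : topologicalType) (f g : T -> X) :
  hausdorff_space X -> continuous f -> continuous g ->
  closed [set x | f x = g x].
Proof.
move=> hX fc gc x clx; apply: hX => A B fA gB.
have nA : nbhs x (f @^-1` A) by exact: fc fA.
have nB : nbhs x (g @^-1` B) by exact: gc gB.
have [y [/= fgy [Ay By]]] := clx _ (filterI nA nB).
by exists (f y); split => //; rewrite fgy.
Qed.

(** * Fixed points of actions on compact spaces *)

Section ExtremeAmenability.
Context {R : realType} {G : zmodType} (c : coordinates G) (e : nat -> G).
Hypothesis e_surj : forall x, exists n, e n = x.
Hypothesis unbounded_G : unbounded_group G.
Variable d : invariant_metrics R G.
Hypothesis dgen : generic e d.

Section Action.
Variables (X : topologicalType) (act : completion d -> X -> X).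
Hypothesis compact_X : compact [set: X].
Hypothesis hausdorff_X : hausdorff_space X.
Hypothesis act0 : forall x, act 0 x = x.
Hypothesis actD : forall a b x, act (a + b) x = act a (act b x).
Hypothesis act_cont : continuous (fun p : completion d * X => act p.1 p.2).

Let gact (g : G) (x : X) : X := act (to_completion d g) x.

Let gactD g h x : gact (g + h) x = gact g (gact h x).
Proof. by rewrite /gact raddfD actD. Qed.

Lemma act_point_continuous a : continuous (act a).
Proof.
move=> x; apply: (@continuous2_cvg _ _ _ _ (nbhs x) _ (cst a) id act a x).
- exact: (@act_cont (a, x)).
- exact: cvg_cst.
- exact: cvg_id.
Qed.

Lemma act_group_continuous x : continuous (act^~ x).
Proof.
move=> a; apply: (@continuous2_cvg _ _ _ _ (nbhs a) _ id (cst x) act a x).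
- exact: (@act_cont (a, x)).
- exact: cvg_id.
- exact: cvg_cst.
Qed.

Lemma separating_function (x y : X) : x <> y -> exists f : X -> R,
  [/\ continuous f, forall z, 0 <= f z <= 1, f x = 0 & f y = 1].
Proof.
move=> xy; have closed1 (z : X) : closed [set z].
  exact: accessible_closed_set1 (hausdorff_accessible hausdorff_X) z.
have /(@uniform_separatorP _ R) [f [fc f01 fx fy]] : uniform_separator [set x] [set y].
  apply: (proj1 (@normal_separatorP R X)) => //; first exact: compact_normal.
  by apply/seteqP; split => // z [-> /xy].
exists f; split => //; last 2 first.
- by apply: fx; exists x.
- by apply: fy; exists y.
by move=> z; have := f01 (f z); rewrite /= in_itv /=; apply; exists z.
Qed.

(** Compactness of [X] makes continuity of the action at 0 uniform in the point, as
    [uniform_oscillation] requires of functions along an orbit. *)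
Lemma act_uniform (f : X -> R) (a : R) : continuous f -> 0 < a ->
  exists2 b, 0 < b & forall g x, mnorm d g < b -> `|f (gact g x) - f x| <= a.
Proof.
move=> fc a0; have /compact_near_coveringP cov := compact_X.
have : \forall u \near (0 : completion d), [set: X] `<=`
    (fun x => `|f (act u x) - f x| <= a).
  apply: (cov _ (nbhs (0 : completion d)) (fun u x => `|f (act u x) - f x| <= a)).
  move=> x _.
  have cont : continuous (fun p : completion d * X => f (act p.1 p.2) - f p.2).
    move=> p; apply: cvgB.
      by apply: continuous_comp; [exact: act_cont|exact: fc].
    by apply: continuous_comp; [exact: cvg_snd|exact: fc].
  have : f (act p.1 p.2) - f p.2 @[p --> ((0 : completion d), x)] --> (0 : R).
    have h0 : f (act 0 x) - f x = 0 by rewrite act0 subrr.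
    by rewrite -h0; exact: (@cont (0, x)).
  move=> /cvgr0Pnorm_le /(_ _ a0).
  case=> -[U V] /= [U0 Vx] UV; exists (V, U) => //= -[x' u] /= [Vx' Uu].
  exact: (UV (u, x')).
move=> /nbhs_ballP [b /= b0 hb]; exists b => // g x gb; apply: (hb (to_completion d g)) => //.
rewrite ballEmdist /= -(raddf0 (to_completion d)) mdist_to.
by rewrite sub0r (seminormN (mnorm_seminorm d)).
Qed.

(** If [f] moves every point of [Y], each [y] has a neighbourhood [U y] on which some function grows
    by more than one half along [f]. By [uniform_oscillation] some point of the orbit of [y0] avoids
    any finitely many of them, against compactness of [Y]. *)
Lemma fixed_point_in_invariant (Y : set X) (f : G) : closed Y -> Y !=set0 ->
  (forall g y, Y y -> Y (gact g y)) -> exists2 y, Y y & gact f y = y.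
Proof.
move=> cY [y0 Yy0] invY; apply: contrapT => nofix.
have /choice [phi hphi] : forall y, exists p : X -> R, [/\ continuous p,
    forall z, 0 <= p z <= 1 & Y y -> p y = 0 /\ p (gact f y) = 1].
  move=> y; have [fy|fy] := pselect (y = gact f y).
    exists (fun=> 0); split; first exact: cst_continuous.
      by move=> z; rewrite lexx ler01.
    by move=> Yy; case: nofix; exists y.
  by have [p [p1 p2 p3 p4]] := separating_function fy; exists p.
pose U y := [set z | 1 / 2 < phi y (gact f z) - phi y z].
have oU y : Y y -> open (U y).
  move=> _; have [pc _ _] := hphi y.
  apply: (@open_comp _ _ (fun z => phi y (gact f z) - phi y z) [set x | 1 / 2 < x]).
    move=> z _; apply: cvgB; last exact: pc.
    by apply: continuous_comp; [exact: act_point_continuous|exact: pc].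
  exact: open_gt.
(* The sets [B r] form a filter base; a cluster point [z] of it would have to avoid its own
   neighbourhood [U z]. *)
pose B (r : seq X) := [set z | Y z /\ forall t, t \in r -> ~ U t z].
have B0 r : B r !=set0.
  have half0 : 0 < 1 / 2 :> R by lra.
  have [||g hg] := @uniform_oscillation R G c e e_surj unbounded_G d dgen X
      r (fun t g => phi t (gact g y0)) f (1 / 2) _ _ half0.
  - by move=> t _ g; have [_ p01 _] := hphi t.
  - move=> t _ a a0; have [pc _ _] := hphi t.
    have [b b0 hb] := act_uniform pc a0; exists b => // u g ub.
    by rewrite gactD; exact: hb.
  exists (gact g y0); split; first exact: invY.
  move=> t tr; have := hg t tr; rewrite gactD ler_norml => /andP [_ le_half].
  by rewrite /U /= ltNge le_half.
have FB : ProperFilter (filter_from [set: seq X] B).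
  apply: filter_from_proper => [|r _]; last exact: B0.
  apply: filter_from_filter; first by exists [::].
  move=> r r' _ _; exists (r ++ r') => // z [Yz hz].
  by split; split => // t tr; apply: hz; rewrite mem_cat tr ?orbT.
have cpY : compact Y by apply: subclosed_compact cY compact_X _.
have [|z [Yz clz]] := cpY _ FB; first by exists [::] => // z [].
have Uz : U z z.
  by have [_ _ /(_ Yz) [p0 p1]] := hphi z; rewrite /U /= p0 p1; lra.
have BF : filter_from [set: seq X] B (B [:: z]) by exists [:: z].
have [w [[_ hw] Uw]] := clz _ _ BF (open_nbhs_nbhs (conj (oU z Yz) Uz)).
by apply: (hw z _ Uw); rewrite inE.
Qed.

(** Commutativity makes the set fixed by the first [n] elements invariant, so the next element has a
    fixed point in it. A cluster point of the points so obtained is fixed by all of [G], and by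
    density by the whole completion. *)
Lemma common_fixed_point : [set: X] !=set0 -> exists x, forall a, act a x = x.
Proof.
move=> X0; have closed_fix a : closed [set x | act a x = x].
  apply: (@closed_equalizer X X (act a) id hausdorff_X _ _).
    exact: act_point_continuous.
  by move=> x; exact: cvg_id.
pose Fix n := [set x | forall i, (i < n)%N -> gact (e i) x = x].
have closed_Fix n : closed (Fix n).
  rewrite (_ : Fix n = \bigcap_(i in [set i | (i < n)%N]) [set x | gact (e i) x = x]).
    by apply: closed_bigI => i _; exact: closed_fix.
  by [].
have Fix0 n : Fix n !=set0.
  elim: n => [|n ihn]; first by have [x _] := X0; exists x.
  have [g y yn i i_n|y yn fy] := fixed_point_in_invariant (e n) (closed_Fix n) ihn.
    by rewrite -gactD addrC gactD yn.
  exists y => i; rewrite ltnS leq_eqVlt => /orP [/eqP -> //|]; exact: yn.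
have [u hu] := choice Fix0.
have [p [_ clp]] := @compact_X (u @ \oo) _ filterT.
have pfix g : gact g p = p.
  have [n <-] := e_surj g.
  apply: (closed_fix (to_completion d (e n))) => V pV.
  have uF : (u @ \oo) [set x | gact (e n) x = x].
    by exists n.+1 => // m /= nm; exact: hu.
  exact: clp uF pV.
exists p => a; have closed_p : closed [set b | act b p = p].
  apply: (@closed_equalizer _ X (act^~ p) (cst p) hausdorff_X _ _).
    exact: act_group_continuous.
  exact: cst_continuous.
apply: closed_p => V aV; have [g ag] : exists g, V (to_completion d g).
  have /nbhs_ballP [eps /= eps0 Vball] := aV.
  have [g ag] := to_completion_approx a eps0; exists g.
  by apply: Vball; rewrite ballEmdist.
by exists (to_completion d g); split => //=; exact: pfix.
Qed.

End Action.

Lemma generic_extremely_amenable : extremely_amenable (completion d).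
Proof.
move=> X act X0 cX hX act0 actD act_cont.
exact: (common_fixed_point cX hX act0 actD act_cont X0).
Qed.

End ExtremeAmenability.

Theorem corollary0p3 (R : realType) (G : zmodType)
    (countable_G : countable [set: G])
    (unbounded_G : unbounded_group G)
    (G_iso_sum : exists f : {additive G -> direct_sum G}, bijective f) :
  exists M : set (invariant_metrics R G),
    [/\ comeager M,
        forall d d' : invariant_metrics R G, M d -> M d' ->
          exists f : {additive completion d -> completion d'},
            bijective f /\ is_isometry f
      & forall d : invariant_metrics R G, M d ->
          isometric_to_Urysohn (completion d) /\
          extremely_amenable (completion d)].
Proof.
have [c] := coordinates_exist G_iso_sum.
have [e e_surj] := countable_enum countable_G.
exists (generic e); split; first exact: comeager_generic.
- by move=> d d' gd gd'; apply: (generic_completions_isometric c e_surj).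
- move=> d gd; split; first exact: (completion_isometric_to_Urysohn c e_surj).
  exact: (generic_extremely_amenable c e_surj).
Qed.
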